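(* For every number of nodes $n \in \mathbb{N}$ and every maximum degree $k \in [n-1]$, the Simple Base-$(k+1)$ Graph $\mathcal{A}_k^{\mathrm{simple}}(V)$ and the Base-$(k+1)$ Graph $\mathcal{A}_k(V)$ on a set $V$ of $n$ nodes are $\mathcal{O}(\log_{k+1}(n))$-finite time convergent. That is, there is an absolute constant $C$ such that for all $n \in \mathbb{N}$ and $k \in [n-1]$, each of these two sequences of graphs is $m$-finite time convergent, where $m$ is its length and $m \le C \log_{k+1}(n)$.
   Context: Notation: $[n] = \{1,\dots,n\}$; $\mathrm{mod}(a,n)$ is the remainder of $a$ divided by $n$; $\mathbf{1}_n$ is the all-ones vector in $\mathbb{R}^n$. All sequences of graphs below live on a common node set, so a sequence of graphs is written as a sequence of (weighted, undirected) edge sets $(E^{(1)},\dots,E^{(m)})$; its length is $|(E^{(1)},\dots,E^{(m)})| = m$. If $\mathcal{S}$ is a sequence, $E(\mathcal{S}^{(j)})$ is the edge set of its $j$-th graph. The mixing matrix $W \in [0,1]^{n\times n}$ of a weighted graph has $W_{ij}$ equal to the weight of edge $(i,j)$ (and $0$ for $i\ne j$ not joined by an edge). Self-loops are not listed; their weights $W_{ii}$ are determined by requiring $W$ to be doubly stochastic. A node is isolated in $E^{(m)}$ if no edge added so far to $E^{(m)}$ is incident to it. Wherever choices are made (ordering of nodes, splitting, selection of nodes, choice of a minimal factorization), any fixed choice is allowed. **Finite-time convergence.** A sequence of graphs $(G^{(1)},\dots,G^{(m)})$ on the same set of $n$ nodes, with mixing matrices $W^{(1)},\dots,W^{(m)}$,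 is $m$-finite time convergent if $X W^{(1)} W^{(2)} \cdots W^{(m)} = \frac1n X \mathbf{1}_n\mathbf{1}_n^\top$ for every $X \in \mathbb{R}^{d\times n}$. **$k$-peer Hyper-hypercube Graph $\mathcal{H}_k(V)$.** Defined for $V = \{v_1,\dots,v_n\}$ when all prime factors of $n$ are at most $k+1$. Write $n = n_1 \times \cdots \times n_L$ with $L \ge 1$ minimum such that $n_l \in [k+1]$ for all $l \in [L]$ (for $n=1$: $L=1$, $n_1=1$). For $i \in [n]$ write $i-1 = \sum_{l=1}^L d_l(i) \prod_{l'<l} n_{l'}$ with digits $0 \le d_l(i) < n_l$. For each $l \in [L]$, $E^{(l)}$ consists of all edges $(v_i,v_j)$, $i \neq j$, such that $d_{l'}(i) = d_{l'}(j)$ for all $l' \neq l$, each with weight $1/n_l$. Then $\mathcal{H}_k(V) = (E^{(1)},\dots,E^{(L)})$. **Simple Base-$(k+1)$ Graph $\mathcal{A}_k^{\mathrm{simple}}(V)$**, $|V| = n$. Write $n$ in base $k+1$: $n = a_1(k+1)^{p_1} + \cdots + a_L(k+1)^{p_L}$ with $p_1 > \cdots > p_L \ge 0$ and $a_l \in [k]$. (i) If all prime factors of $n$ are at most $k+1$, return $\mathcal{H}_k(V)$. (ii) Otherwise, split $V$ into disjoint subsets $V_1,\dots,V_L$ with $|V_l| = a_l(k+1)^{p_l}$, and split each $V_l$ into disjoint subsets $V_{l,1},\dots,V_{l,a_l}$ with $|V_{l,a}| = (k+1)^{p_l}$. Construct all $\mathcal{H}_k(V_l)$ and $\mathcal{H}_k(V_{l,a})$,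 and let $m_1 = |\mathcal{H}_k(V_1)|$. Initialize $b_l = 0$ for all $l \in [L]$ and $m = 0$. While $b_1 < |\mathcal{H}_k(V_{1,1})|$: set $m \leftarrow m+1$, $E^{(m)} \leftarrow \emptyset$, and for $l = L, L-1, \dots, 1$ in this order do the first applicable case: - if $m \le m_1$: add $E(\mathcal{H}_k(V_l)^{(m')})$ to $E^{(m)}$, where $m' = \mathrm{mod}(m-1, |\mathcal{H}_k(V_l)|)+1$; - else if $m < m_1 + l$: for each $v \in V_l$, select isolated nodes $u_1 \in V_{m-m_1,1}, \dots, u_{a_{m-m_1}} \in V_{m-m_1,a_{m-m_1}}$ and add the edges $(v,u_1),\dots,(v,u_{a_{m-m_1}})$ to $E^{(m)}$, each with weight $\frac{|V_{m-m_1}|}{a_{m-m_1}\sum_{l'=m-m_1}^{L}|V_{l'}|}$; - else if $m = m_1 + l$ and $l \ne L$: while there are two or more isolated nodes in $V_l$, let $c$ be their number, select a set $V'$ of $\min\{k+1,c\}$ isolated nodes of $V_l$, and add to $E^{(m)}$ all edges of the complete graph on $V'$ with weights $1/|V'|$; - else: set $b_l \leftarrow b_l + 1$; if $p_l \neq 0$, add $E(\mathcal{H}_k(V_{l,a})^{(m')})$ to $E^{(m)}$ for every $a \in [a_l]$, where $m' = \mathrm{mod}(b_l - 1, |\mathcal{H}_k(V_{l,a})|)+1$; if $p_l = 0$, add $E(\mathcal{H}_k(V_l)^{(m')})$ to $E^{(m)}$, where $m' = \mathrm{mod}(b_l-1,|\mathcal{H}_k(V_l)|)+1$. Return $(E^{(1)},\dots,E^{(m)})$.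 **Base-$(k+1)$ Graph $\mathcal{A}_k(V)$**, $|V| = n$. Write $n = p \times q$ where all prime factors of $p$ are at most $k+1$ and $q$ is coprime to each of $2,3,\dots,k+1$. Split $V$ into disjoint subsets $V_1,\dots,V_p$ with $|V_l| = q$, and construct $\mathcal{A}_k^{\mathrm{simple}}(V_l)$ for all $l \in [p]$ (all built in the same way, so of equal length). For $m = 1,\dots,|\mathcal{A}_k^{\mathrm{simple}}(V_1)|$ let $E^{(m)} = \bigcup_{l \in [p]} E(\mathcal{A}_k^{\mathrm{simple}}(V_l)^{(m)})$. Split $V$ into disjoint subsets $U_1,\dots,U_q$ with $|U_l| = p$ and $|U_l \cap V_{l'}| = 1$ for all $l,l'$, and construct $\mathcal{H}_k(U_l)$ for all $l \in [q]$ (built in the same way, using the same factorization of $p$). For $m = 1,\dots,|\mathcal{H}_k(U_1)|$ let $E^{(m+|\mathcal{A}_k^{\mathrm{simple}}(V_1)|)} = \bigcup_{l\in[q]} E(\mathcal{H}_k(U_l)^{(m)})$. Let $\mathcal{E}$ be the resulting sequence, of length $|\mathcal{A}_k^{\mathrm{simple}}(V_1)| + |\mathcal{H}_k(U_1)|$. If $|\mathcal{A}_k^{\mathrm{simple}}(V)| < |\mathcal{E}|$, return $\mathcal{A}_k^{\mathrm{simple}}(V)$; otherwise return $\mathcal{E}$. *)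

(* Defs.v *)
(* Nodes are the elements of 'I_n.  A set of weighted undirected edges is the
   symmetric matrix E : 'M[R]_n whose entry E i j is the weight of the edge
   (i, j), and 0 when i and j are not joined; its diagonal is 0.  All weights
   below are nonzero, and edge sets are only ever united when they are
   disjoint, so that union is addition of matrices and the empty edge set is 0.

   Every choice left open by a construction is rendered by a relation "Es is a
   possible outcome of the construction on V".  Indices written l, a, m below
   start at 1 unless stated otherwise; families indexed by 1, ..., L are
   functions on nat whose other values are irrelevant.  *)
From mathcomp Require Import all_boot all_order all_algebra all_fingroup.
From mathcomp Require Import reals exp.

Set Implicit Arguments.
Unset Strict Implicit.
Unset Printing Implicit Defensive.

Import Order.TTheory GRing.Theory Num.Theory.
Local Open Scope ring_scope.

Definition mixing_matrix (R : realType) (n : nat) (E : 'M[R]_n) : 'M[R]_n :=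
  \matrix_(i, j) if i == j then 1 - \sum_(l | l != i) E i l else E i j.

Definition doubly_stochastic (R : realType) (n : nat) (W : 'M[R]_n) : Prop :=
  [/\ forall i j, 0 <= W i j <= 1,
      forall i, \sum_j W i j = 1
    & forall j, \sum_i W i j = 1].

(* The self-loop weights put on the diagonal by [mixing_matrix] are the only
   ones for which the rows sum to 1; that the result is a mixing matrix, i.e.
   doubly stochastic with entries in [0, 1], is part of the property.  *)
Definition finite_time_convergent (R : realType) (n m : nat)
    (Es : seq 'M[R]_n) : Prop :=
  [/\ size Es = m,
      forall E, E \in Es -> doubly_stochastic (mixing_matrix E)
    & forall (d : nat) (X : 'M[R]_(d, n)),
        X *m \big[mulmx/1%:M]_(E <- Es) mixing_matrix E
        = n%:R^-1 *: (X *m (const_mx 1 : 'cV_n) *m (const_mx 1 : 'cV_n)^T)].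

Definition logb (R : realType) (b x : R) : R := ln x / ln b.

Definition smooth (k n : nat) : bool := all (fun r => r <= k.+1)%N (primes n).

Definition splits (n : nat) (V : {set 'I_n}) (L : nat)
    (Vs : nat -> {set 'I_n}) (c : nat -> nat) : Prop :=
  [/\ V = \bigcup_(1 <= l < L.+1) Vs l,
      forall l l', (1 <= l <= L)%N -> (1 <= l' <= L)%N -> l != l' ->
        [disjoint Vs l & Vs l']
    & forall l, (1 <= l <= L)%N -> #|Vs l| = c l].

Definition clique (R : realType) (n : nat) (V : {set 'I_n}) : 'M[R]_n :=
  \matrix_(x, y) if [&& x \in V, y \in V & x != y] then #|V|%:R^-1 else 0.

Definition edge (R : realType) (n : nat) (v u : 'I_n) (w : R) : 'M[R]_n :=
  \matrix_(x, y)
    if (x == v) && (y == u) || (x == u) && (y == v) then w else 0.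

Definition isolated (R : realType) (n : nat) (E : 'M[R]_n) : {set 'I_n} :=
  [set x | [forall y, E x y == 0]].

Definition factorization (k n : nat) (ns : seq nat) : Prop :=
  [/\ (0 < size ns)%N,
      (\prod_(x <- ns) x)%N = n
    & all (fun x => 1 <= x <= k.+1)%N ns].

Definition min_factorization (k n : nat) (ns : seq nat) : Prop :=
  factorization k n ns /\
  forall ns', factorization k n ns' -> (size ns <= size ns')%N.

(* The digit of i at position l (positions and i start at 0) in the mixed
   radix system with bases ns, least significant first.  *)
Definition digit (ns : seq nat) (i l : nat) : nat :=
  ((i %/ \prod_(x <- take l ns) x) %% nth 1 ns l)%N.

(* l starts at 0; the node v_i is the (i-1)-th item of the sequence v. *)
Definition hyper_edges (R : realType) (n : nat) (ns : seq nat) (v : seq 'I_n)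
    (l : nat) : 'M[R]_n :=
  \matrix_(x, y)
    if [&& x \in v, y \in v, x != y &
        [forall l' : 'I_(size ns), (l' != l :> nat) ==>
           (digit ns (index x v) l' == digit ns (index y v) l')]]
    then (nth 1%N ns l)%:R^-1 else 0.

Definition hyper_hypercube (R : realType) (n k : nat) (V : {set 'I_n})
    (Es : seq 'M[R]_n) : Prop :=
  exists (ns : seq nat) (v : seq 'I_n),
    [/\ min_factorization k #|V| ns, uniq v, v =i V
      & Es = mkseq (hyper_edges R ns v) (size ns)].

(* The data built before the main loop: n = \sum_l a_l (k+1)^(p_l), the sets
   V_l and V_{l,a}, and the graphs H_k(V_l) and H_k(V_{l,a}).  *)
Record splitting (R : realType) (n : nat) := Splitting {
  sL : nat;
  sa : nat -> nat;
  sp : nat -> nat;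
  sV : nat -> {set 'I_n};
  sVV : nat -> nat -> {set 'I_n};
  sH : nat -> seq 'M[R]_n;
  sHH : nat -> nat -> seq 'M[R]_n }.

Record valid_splitting (R : realType) (n k : nat) (V : {set 'I_n})
    (s : splitting R n) : Prop := ValidSplitting {
  vs_base : #|V| = (\sum_(1 <= l < (sL s).+1) sa s l * k.+1 ^ sp s l)%N;
  vs_pow : forall l l', (1 <= l)%N -> (l < l')%N -> (l' <= sL s)%N ->
    (sp s l' < sp s l)%N;
  vs_dig : forall l, (1 <= l <= sL s)%N -> (1 <= sa s l <= k)%N;
  vs_V : splits V (sL s) (sV s) (fun l => sa s l * k.+1 ^ sp s l)%N;
  vs_VV : forall l, (1 <= l <= sL s)%N ->
    splits (sV s l) (sa s l) (sVV s l) (fun _ => k.+1 ^ sp s l)%N;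
  vs_H : forall l, (1 <= l <= sL s)%N -> hyper_hypercube k (sV s l) (sH s l);
  vs_HH : forall l c, (1 <= l <= sL s)%N -> (1 <= c <= sa s l)%N ->
    hyper_hypercube k (sVV s l c) (sHH s l c) }.

(* The graph of index mod(i-1, |S|) + 1 in S. *)
Definition cyc (R : realType) (n : nat) (S : seq 'M[R]_n) (i : nat) : 'M[R]_n :=
  nth 0 S (i.-1 %% size S).

Definition link_weight (R : realType) (n : nat) (s : splitting R n) (j : nat) : R :=
  #|sV s j|%:R / (sa s j * \sum_(j <= l < (sL s).+1) #|sV s l|)%N%:R.

(* link s j vs E E': starting from the edge set E, each v in vs, in this order,
   is joined to one isolated node of each of V_{j,1}, ..., V_{j,a_j}.  *)
Inductive link (R : realType) (n : nat) (s : splitting R n) (j : nat) :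
    seq 'I_n -> 'M[R]_n -> 'M[R]_n -> Prop :=
| Link_nil E : link s j [::] E E
| Link_cons v vs (u : nat -> 'I_n) E E' :
    (forall c, (1 <= c <= sa s j)%N -> u c \in sVV s j c :&: isolated E) ->
    link s j vs
      (E + \sum_(1 <= c < (sa s j).+1) edge v (u c) (link_weight s j)) E' ->
    link s j (v :: vs) E E'.

Inductive group_isolated (R : realType) (n k : nat) (V : {set 'I_n}) :
    'M[R]_n -> 'M[R]_n -> Prop :=
| Group_stop E : (#|V :&: isolated E| < 2)%N -> group_isolated k V E E
| Group_step (V' : {set 'I_n}) E E' :
    (2 <= #|V :&: isolated E|)%N ->
    V' \subset V :&: isolated E ->
    #|V'| = minn k.+1 #|V :&: isolated E| ->
    group_isolated k V (E + clique R V') E' ->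
    group_isolated k V E E'.

(* One pass of the body of the "for l" loop at round m, from the edge set E and
   the counters b to the edge set E' and the counters b'.  *)
Definition for_body (R : realType) (n k : nat) (s : splitting R n) (m l : nat)
    (E : 'M[R]_n) (b : nat -> nat) (E' : 'M[R]_n) (b' : nat -> nat) : Prop :=
  let m1 := size (sH s 1) in
  if (m <= m1)%N then
    E' = E + cyc (sH s l) m /\ b' = b
  else if (m < m1 + l)%N then
    (exists vs : seq 'I_n,
       [/\ uniq vs, vs =i sV s l & link s (m - m1) vs E E']) /\ b' = b
  else if (m == m1 + l)%N && (l != sL s) then
    group_isolated k (sV s l) E E' /\ b' = b
  else
    let bl := (b l).+1 in
    b' = [eta b with l |-> bl] /\
    E' = E + (if sp s l != 0%N
              then \sum_(1 <= c < (sa s l).+1) cyc (sHH s l c) bl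
              else cyc (sH s l) bl).

Inductive for_loop (R : realType) (n k : nat) (s : splitting R n) (m : nat) :
    seq nat -> 'M[R]_n -> (nat -> nat) -> 'M[R]_n -> (nat -> nat) -> Prop :=
| For_nil E b : for_loop k s m [::] E b E b
| For_cons l ls E b E1 b1 E' b' :
    for_body k s m l E b E1 b1 ->
    for_loop k s m ls E1 b1 E' b' ->
    for_loop k s m (l :: ls) E b E' b'.

(* while_loop k s m b Es: from the values m and b of the variables, the loop
   terminates after producing the edge sets Es = (E^(m+1), E^(m+2), ...).  *)
Inductive while_loop (R : realType) (n k : nat) (s : splitting R n) :
    nat -> (nat -> nat) -> seq 'M[R]_n -> Prop :=
| While_stop m b : (size (sHH s 1 1) <= b 1)%N -> while_loop k s m b [::]
| While_step m b E b' Es :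
    (b 1 < size (sHH s 1 1))%N ->
    for_loop k s m.+1 (rev (iota 1 (sL s))) 0 b E b' ->
    while_loop k s m.+1 b' Es ->
    while_loop k s m b (E :: Es).

Definition simple_base_graph (R : realType) (n k : nat) (V : {set 'I_n})
    (Es : seq 'M[R]_n) : Prop :=
  if smooth k #|V| then hyper_hypercube k V Es
  else exists s : splitting R n,
    valid_splitting k V s /\ while_loop k s 0 (fun _ => 0%N) Es.

Definition relabel (R : realType) (n : nat) (f : 'S_n) (E : 'M[R]_n) : 'M[R]_n :=
  \matrix_(x, y) E ((f^-1)%g x) ((f^-1)%g y).

(* S' on V' is built in the same way as S on V: it is the image of S under a
   renaming of the nodes that maps V to V'.  *)
Definition same_way (R : realType) (n : nat) (V : {set 'I_n}) (S : seq 'M[R]_n)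
    (V' : {set 'I_n}) (S' : seq 'M[R]_n) : Prop :=
  exists f : 'S_n, [set f x | x in V] = V' /\ S' = map (relabel f) S.

(* The sequence of the unions of the graphs of index m of S 1, ..., S p. *)
Definition union_seq (R : realType) (n p : nat) (S : nat -> seq 'M[R]_n) :
    seq 'M[R]_n :=
  mkseq (fun m => \sum_(1 <= l < p.+1) nth 0 (S l) m) (size (S 1%N)).

(* Es is a possible value of the concatenated sequence that is compared with
   the simple graph.  *)
Definition product_graph (R : realType) (n k : nat) (V : {set 'I_n})
    (Es : seq 'M[R]_n) : Prop :=
  exists (p q : nat) (Vs Us : nat -> {set 'I_n}) (A H : nat -> seq 'M[R]_n),
    [/\ [/\ #|V| = (p * q)%N, smooth k p
          & forall c, (2 <= c <= k.+1)%N -> coprime q c],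
        [/\ splits V p Vs (fun _ => q), splits V q Us (fun _ => p)
          & forall l l', (1 <= l <= q)%N -> (1 <= l' <= p)%N ->
              #|Us l :&: Vs l'| = 1%N],
        forall l, (1 <= l <= p)%N ->
          simple_base_graph k (Vs l) (A l) /\
          same_way (Vs 1%N) (A 1%N) (Vs l) (A l),
        forall l, (1 <= l <= q)%N ->
          hyper_hypercube k (Us l) (H l) /\
          same_way (Us 1%N) (H 1%N) (Us l) (H l)
      & Es = union_seq p A ++ union_seq q H].

Definition base_graph (R : realType) (n k : nat) (V : {set 'I_n})
    (Es : seq 'M[R]_n) : Prop :=
  exists As Ps : seq 'M[R]_n,
    [/\ simple_base_graph k V As, product_graph k V Ps
      & Es = if (size As < size Ps)%N then As else Ps].

(* Main.v *)
(* Edge sets act on node values by x_j |-> x_j + \sum_i E_ij (x_i - x_j), and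
   this action is local to the blocks of a partition that E respects.

   In H_k(V), step t averages over the t-th digit, so after step t the value of
   a node depends only on the digits above t.

   In the simple graph let N_l = |V_l|, T_j = \sum_(l >= j) N_l, and let m1 be
   the length of H_k(V_1).  After m1 rounds every V_l, l >= 1, is constant, say
   equal to y_l.  Round m1 + j moves y_l, l > j, to
   y_l + (N_j / T_j) (y_j - y_l).  This keeps the N_l-weighted mean of the y_l,
   now over l > j only, equal to the global mean, and leaves every V_{j,a} with
   the global mean as its average; there are enough isolated nodes because
   T_(j+1) < (k+1)^(p_j) = |V_{j,a}|.  The remaining p_1 + 1 - j >= p_j rounds
   average each V_{j,a}, j < L, while V_L is already constant.

   The length is m1 + 1 + p_1 <= 2 p_1 + 2, hence (k+1)^length <= n^4; this also
   holds for H_k(V), and the Base-(k+1) graph is never longer than the simple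
   one. *)
Require Import Defs.
From mathcomp Require Import all_boot all_order all_algebra all_fingroup.
From mathcomp Require Import reals exp.
From mathcomp Require Import boolp ring lra zify.

Set Implicit Arguments.
Unset Strict Implicit.
Unset Printing Implicit Defensive.

Import Order.TTheory GRing.Theory Num.Theory.
Local Open Scope ring_scope.

(** * Mixing *)

(** The constructions are relations, so a claim about all outcomes would be empty if a selection
    could fail or the loop could run forever. The loops are therefore treated by total correctness:
    an outcome exists, and every outcome has the described shape.

    The free choices do not affect the values because only totals enter. In round m1 + j a node of
    V_l, l > j, meets V_j, whose nodes all carry y_j, with total weight N_j / T_j, and it meets each
    block V_{j,a} with weight N_j / (a_j T_j) = (k+1)^(p_j) / T_j. Edges inside V_j, such as those
    of the grouping, join equal values in that round and change nothing.

    The exponent 4 comes from (k+1)^(p_1) <= n and k+1 <= n. For H_k(V) the factors are unknown;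
    minimality forbids two factors that could be merged, and this bounds their number.

    The sequence compared with the simple graph needs copies built in the same way. They are
    obtained by renaming the nodes of one outcome, so every step of the construction is shown to be
    equivariant under permutations. *)

Lemma bigcup_natP (T : finType) (F : nat -> {set T}) m t x :
  reflect (exists2 l, (m <= l < t)%N & x \in F l)
          (x \in \bigcup_(m <= l < t) F l).
Proof.
have in_bigcup s : (x \in \bigcup_(l <- s) F l) = has (fun l => x \in F l) s.
  by elim: s => [|l s IHs]; rewrite ?big_nil ?inE // big_cons inE IHs.
rewrite in_bigcup; apply: (iffP hasP) => -[l lP xl]; exists l => //;
  by rewrite mem_index_iota in lP *.
Qed.

(** * The action of edge sets on node values: locality and conservation of sums *)

Section Mixing.
Variables (R : realType) (n : nat).
Implicit Types (E F : 'M[R]_n) (x y : 'I_n -> R) (U V W : {set 'I_n}).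
Implicit Types (Es Fs : seq 'M[R]_n).

(** The difference [x i - x j] absorbs the self-loop weight, and the new value at j involves column
    j of [E] only. All later comparisons of edge sets are therefore made column by column. *)
Definition mix E x (j : 'I_n) : R := x j + \sum_i E i j * (x i - x j).

Definition run (Es : seq 'M[R]_n) x := foldl (fun y E => mix E y) x Es.

(** Symmetry and row sums at most 1 leave a nonnegative self-loop weight at each node; the support
    in V allows graphs on disjoint sets to be run side by side. *)
Record graph_on V E : Prop := GraphOn {
  graph_sym : forall i j, E i j = E j i;
  graph_ge0 : forall i j, 0 <= E i j;
  graph_supp : forall i j, i \notin V -> E i j = 0;
  graph_row : forall i, \sum_j E i j <= 1 }.

Definition averages V (Es : seq 'M[R]_n) : Prop :=
  (forall E, E \in Es -> graph_on V E) /\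
  forall x v, v \in V -> run Es x v = #|V|%:R^-1 * \sum_(i in V) x i.

Lemma graph_supp_r V E i j : graph_on V E -> j \notin V -> E i j = 0.
Proof. by move=> g jV; rewrite (graph_sym g) (graph_supp g). Qed.

Lemma graph_on_sub U V E : U \subset V -> graph_on U E -> graph_on V E.
Proof.
move=> sUV [sE pE uE rE]; split=> // i j iV; apply: uE.
by apply: contra iV; apply: subsetP.
Qed.

Lemma graph_on0 V : graph_on V 0.
Proof.
split=> [i j|i j|i j _|i]; rewrite ?mxE //.
by rewrite big1 ?ler01 // => j _; rewrite mxE.
Qed.

(** Disjointness is what keeps the row sums below 1: each row is nonzero in at most one of the two
    summands. *)
Lemma graph_on_add U V W E F : U \subset W -> V \subset W -> [disjoint U & V] ->
  graph_on U E -> graph_on V F -> graph_on W (E + F).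
Proof.
move=> sUW sVW dUV gE gF; split.
- by move=> i j; rewrite !mxE (graph_sym gE) (graph_sym gF).
- by move=> i j; rewrite mxE addr_ge0 ?(graph_ge0 gE) ?(graph_ge0 gF).
- move=> i j iW; rewrite mxE (graph_supp gE) ?(graph_supp gF) ?addr0 //.
    by apply: contra iW; apply: subsetP.
  by apply: contra iW; apply: subsetP.
- move=> i; case: (boolP (i \in U)) => iU.
    have iV : i \notin V by rewrite (disjointFr dUV).
    under eq_bigr => j _ do rewrite mxE (graph_supp gF) // addr0.
    exact: graph_row gE i.
  under eq_bigr => j _ do rewrite mxE (graph_supp gE) // add0r.
  exact: graph_row gF i.
Qed.

Lemma graph_on_sum V (Vs : nat -> {set 'I_n}) (D : nat -> 'M[R]_n) t :
  (forall l, (1 <= l < t)%N -> graph_on (Vs l) (D l)) ->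
  (forall l, (1 <= l < t)%N -> Vs l \subset V) ->
  (forall l l', (1 <= l < t)%N -> (1 <= l' < t)%N -> l != l' ->
    [disjoint Vs l & Vs l']) ->
  graph_on V (\sum_(1 <= l < t) D l).
Proof.
move=> gD sV dV.
have: graph_on (\bigcup_(1 <= l < t) Vs l) (\sum_(1 <= l < t) D l).
  elim: t gD sV dV => [|[|t] IHt] gD sV dV.
  - by rewrite !big_geq //; apply: graph_on0.
  - by rewrite !big_geq //; apply: graph_on0.
  rewrite !(big_nat_recr t.+1) //=.
  apply: (graph_on_add (subsetUl _ _) (subsetUr _ _)).
  - rewrite disjoints_subset; apply/subsetP => x /bigcup_natP[l lt xl].
    rewrite inE (disjointFr (dV l t.+1 _ _ _) xl) //; lia.
  - apply: IHt => [l lt|l lt|l l' lt lt']; [apply: gD|apply: sV|apply: dV]; lia.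
  - by apply: gD; lia.
apply: graph_on_sub; apply/subsetP => x /bigcup_natP[l lt].
exact: (subsetP (sV l lt)).
Qed.

Lemma mixing_doubly_stochastic V E :
  graph_on V E -> doubly_stochastic (mixing_matrix E).
Proof.
move=> g.
have W1 i : \sum_j mixing_matrix E i j = 1.
  rewrite (bigD1 i) //= mxE eqxx.
  rewrite [X in _ + X](eq_bigr (fun j => E i j)) ?subrK // => j ji.
  by rewrite mxE eq_sym (negPf ji).
have Wsym i j : mixing_matrix E i j = mixing_matrix E j i.
  rewrite !mxE eq_sym; case: eqP => [->//|_]; exact: graph_sym g i j.
have r1 i (P : pred 'I_n) : \sum_(j | P j) E i j <= 1.
  apply: le_trans (graph_row g i).
  rewrite [leRHS](bigID P) /= lerDl sumr_ge0 // => j _; exact: graph_ge0 g i j.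
split=> // [i j|j]; last by under eq_bigr => i _ do rewrite Wsym.
rewrite mxE; case: eqP => _.
  rewrite subr_ge0 r1 /= gerBl sumr_ge0 // => l _; exact: graph_ge0 g i l.
rewrite (graph_ge0 g) /=; have := r1 i (pred1 j); by rewrite big_pred1_eq.
Qed.

Lemma mulmx_mixing d (X : 'M[R]_(d, n)) V E a j : graph_on V E ->
  (X *m mixing_matrix E) a j = mix E (X a) j.
Proof.
move=> g; rewrite mxE /mix (bigD1 j) //= [in RHS](bigD1 j) //= subrr mulr0 add0r.
rewrite mxE eqxx mulrBr mulr1 -addrA; congr (_ + _).
rewrite mulr_sumr -sumrN -big_split /=; apply: eq_bigr => i ij.
rewrite mxE (negPf ij) (graph_sym g j i); ring.
Qed.

Lemma run_mulmx d (X : 'M[R]_(d, n)) V Es a j :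
  (forall E, E \in Es -> graph_on V E) ->
  (X *m \big[mulmx/1%:M]_(E <- Es) mixing_matrix E) a j = run Es (X a) j.
Proof.
elim: Es X => [|E Es IHEs] X gEs; first by rewrite big_nil mulmx1.
rewrite big_cons mulmxA IHEs => [|F FEs]; last by apply: gEs; rewrite inE FEs orbT.
rewrite /run /=; congr (foldl _ _ _ _); apply: funext => i.
rewrite (@mulmx_mixing _ _ V) //; apply: gEs; exact: mem_head.
Qed.

Lemma averages_finite_time_convergent Es :
  averages [set: 'I_n] Es -> finite_time_convergent (size Es) Es.
Proof.
case=> gEs avEs; split=> // [E /gEs|d X]; first exact: mixing_doubly_stochastic.
apply/matrixP => a j; rewrite (run_mulmx _ _ _ gEs) avEs // cardsT card_ord.
rewrite mxE mxE big_ord1 !mxE mulr1; congr (_ * _).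
rewrite [LHS](eq_bigl predT) => [|i]; last by rewrite inE.
by apply: eq_bigr => i _; rewrite mxE mulr1.
Qed.

Lemma run_cat Es Fs x : run (Es ++ Fs) x = run Fs (run Es x).
Proof. exact: foldl_cat. Qed.

Lemma run_rcons Es E x : run (rcons Es E) x = mix E (run Es x).
Proof. exact: foldl_rcons. Qed.

(** This is what replaces a global edge set [E] by the local piece [F] that it induces on U: only
    the columns of U have to agree, provided no edge of [F] leaves U. *)
Lemma mix_local U E F x y :
  (forall v i, v \in U -> E i v = F i v) ->
  (forall v i, v \in U -> i \notin U -> F i v = 0) ->
  (forall v, v \in U -> x v = y v) ->
  forall v, v \in U -> mix E x v = mix F y v.
Proof.
move=> EF F0 xy v vU; rewrite /mix xy //; congr (_ + _).
apply: eq_bigr => i _; rewrite EF //.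
by case: (boolP (i \in U)) => iU; [rewrite xy | rewrite F0 ?mul0r].
Qed.

Lemma run_local U Es Fs x y : size Es = size Fs ->
  (forall m v i, (m < size Fs)%N -> v \in U ->
    (nth 0 Es m : 'M[R]_n) i v = (nth 0 Fs m : 'M[R]_n) i v) ->
  (forall F v i, F \in Fs -> v \in U -> i \notin U -> F i v = 0) ->
  (forall v, v \in U -> x v = y v) ->
  forall v, v \in U -> run Es x v = run Fs y v.
Proof.
elim: Es Fs x y => [|E Es IHEs] [|F Fs] x y //= sEF EF F0 xy v vU.
case: sEF => sEF.
apply: IHEs => // [m w i mFs wU|G w i GFs|w wU].
- exact: (EF m.+1 w i mFs wU).
- by apply: F0; rewrite inE GFs orbT.
- apply: (@mix_local U) => // [u i uU|u i uU]; first exact: (EF 0%N u i isT uU).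
  by apply: F0; rewrite ?mem_head.
Qed.

Lemma mix_const V E x c : (forall v i, v \in V -> i \notin V -> E i v = 0) ->
  (forall v, v \in V -> x v = c) -> forall v, v \in V -> mix E x v = c.
Proof.
move=> E0 xc v vV; rewrite /mix xc // big1 ?addr0 // => i _.
by case: (boolP (i \in V)) => iV; [rewrite xc ?subrr ?mulr0 | rewrite E0 ?mul0r].
Qed.

Lemma run_const V Es x c :
  (forall E v i, E \in Es -> v \in V -> i \notin V -> E i v = 0) ->
  (forall v, v \in V -> x v = c) -> forall v, v \in V -> run Es x v = c.
Proof.
elim: Es x => [|E Es IHEs] x E0 xc //; apply: IHEs => [F v i FEs|].
  by apply: E0; rewrite inE FEs orbT.
by apply: mix_const => // v i; apply: E0; rewrite mem_head.
Qed.

Lemma mix_sum V E x : graph_on V E ->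
  \sum_(v in V) mix E x v = \sum_(v in V) x v.
Proof.
move=> g; rewrite big_split /= -[RHS]addr0; congr (_ + _).
have swap : \sum_(v in V) \sum_i E i v * (x i - x v) =
            \sum_(v in V) \sum_(i in V) E i v * (x i - x v).
  apply: eq_bigr => v _; rewrite (bigID (mem V)) /= [X in _ + X]big1 ?addr0 //.
  by move=> i iV; rewrite (graph_supp g) ?mul0r.
rewrite swap; set S := LHS.
(* Exchanging the two sums and using the symmetry of [E] turns every term into its opposite: what
   one endpoint gains, the other loses. *)
have: S = - S.
  rewrite {1}/S exchange_big /= -sumrN; apply: eq_bigr => i _.
  rewrite -sumrN; apply: eq_bigr => j _; rewrite (graph_sym g); ring.
lra.
Qed.

Lemma run_sum V Es x : (forall E, E \in Es -> graph_on V E) ->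
  \sum_(v in V) run Es x v = \sum_(v in V) x v.
Proof.
elim: Es x => [|E Es IHEs] x gEs //; rewrite [LHS]IHEs => [|F FEs].
  by rewrite mix_sum //; apply: gEs; rewrite mem_head.
by apply: gEs; rewrite inE FEs orbT.
Qed.

End Mixing.

(** * Hyper-hypercubes *)

Section MixedRadix.
Local Open Scope nat_scope.
Implicit Types (ns : seq nat) (i j t l : nat).

Definition radix ns t := \prod_(x <- take t ns) x.

Lemma radixS ns t : t < size ns -> radix ns t.+1 = nth 1 ns t * radix ns t.
Proof.
by move=> lt_t; rewrite /radix (take_nth 1) // big_rcons mulnC.
Qed.

Lemma radix_dvd ns t u : t <= u -> radix ns t %| radix ns u.
Proof.
move=> /subnKC <-; rewrite /radix takeD big_cat; exact: dvdn_mulr.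
Qed.

Lemma radix_gt0 ns t : all (fun x => 0 < x) ns -> 0 < radix ns t.
Proof.
move=> /allP ns0; rewrite /radix big_seq; apply: prodn_cond_gt0 => x /mem_take.
exact: ns0.
Qed.

Lemma digitE ns i t : t < size ns ->
  digit ns i t = (i %% radix ns t.+1) %/ radix ns t.
Proof. by move=> lt_t; rewrite radixS // /digit -/(radix ns t) modn_divl. Qed.

Lemma modn_radixS ns i t : t < size ns ->
  i %% radix ns t.+1 = digit ns i t * radix ns t + i %% radix ns t.
Proof.
move=> lt_t; rewrite [LHS](divn_eq _ (radix ns t)) -digitE //.
by rewrite modn_dvdm // radix_dvd.
Qed.

Lemma divn_radix ns i t : t < size ns ->
  i %/ radix ns t = (i %/ radix ns t.+1) * nth 1 ns t + digit ns i t.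
Proof.
move=> lt_t; rewrite radixS // (mulnC (nth 1 ns t)) divnMA.
exact: divn_eq.
Qed.

(** The digits below t are encoded by the remainder modulo [radix ns t], those above t by the
    quotient by [radix ns t.+1]. This turns the condition defining the edges of a hyper-hypercube
    into arithmetic. *)
Lemma digits_but_one ns i j t : all (fun x => 0 < x) ns -> t < size ns ->
  i < radix ns (size ns) -> j < radix ns (size ns) ->
  (forall l, l < size ns -> l != t -> digit ns i l = digit ns j l) <->
  i = j %[mod radix ns t] /\ i %/ radix ns t.+1 = j %/ radix ns t.+1.
Proof.
move=> ns0 lt_t lt_i lt_j; split=> [eq_ij|[eq_mod eq_div] l lt_l].
  split.
    have: t <= t by []; elim: {-2}t => [|u IHu] le_u.
      by rewrite /radix take0 big_nil !modn1.
    by rewrite !modn_radixS ?eq_ij ?IHu //; lia.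
  (* Downward induction from [size ns], where both quotients are 0. *)
  have eq_div d u : u + d = size ns -> t < u -> i %/ radix ns u = j %/ radix ns u.
    elim: d u => [|d IHd] u; first by rewrite addn0 => -> _; rewrite !divn_small.
    move=> ud tu; rewrite !(@divn_radix ns _ u) ?eq_ij ?(IHd u.+1) //; lia.
  exact: (eq_div (size ns - t.+1) _ (subnKC lt_t)).
rewrite neq_ltn => /orP[lt_lt|gt_lt].
  by rewrite !digitE // -(modn_dvdm _ (radix_dvd ns lt_lt)) eq_mod modn_dvdm // radix_dvd.
rewrite /digit -!/(radix ns l) -(divnK (radix_dvd ns gt_lt)) mulnC.
by rewrite !divnMA eq_div.
Qed.

Definition with_digit ns i t c :=
  i %/ radix ns t.+1 * radix ns t.+1 + (c * radix ns t + i %% radix ns t).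

Lemma with_digit_id ns i t : t < size ns -> with_digit ns i t (digit ns i t) = i.
Proof. by move=> lt_t; rewrite /with_digit -modn_radixS // -divn_eq. Qed.

Section WithDigit.
Variables (ns : seq nat) (i t c : nat).
Hypotheses (ns0 : all (fun x => 0 < x) ns) (lt_t : t < size ns).
Hypothesis lt_c : c < nth 1 ns t.

Lemma with_digit_rest : c * radix ns t + i %% radix ns t < radix ns t.+1.
Proof.
have P0 := radix_gt0 t ns0; rewrite radixS //.
apply: leq_trans (_ : c.+1 * radix ns t <= _); last by rewrite leq_mul2r lt_c orbT.
by rewrite mulSn addnC ltn_add2r ltn_mod.
Qed.

Lemma with_digit_mod : with_digit ns i t c = i %[mod radix ns t].
Proof.
rewrite /with_digit -modnDml (eqP (dvdn_mull _ (radix_dvd ns (leqnSn t)))) add0n.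
by rewrite modnMDl modn_mod.
Qed.

Lemma with_digit_div : with_digit ns i t c %/ radix ns t.+1 = i %/ radix ns t.+1.
Proof.
by rewrite /with_digit divnMDl ?radix_gt0 // (divn_small with_digit_rest) addn0.
Qed.

Lemma with_digit_divS :
  with_digit ns i t c %/ radix ns t = i %/ radix ns t.+1 * nth 1 ns t + c.
Proof.
rewrite /with_digit {2}radixS // addnA mulnA -mulnDl divnMDl ?radix_gt0 //.
by rewrite (@divn_small (i %% _)) ?addn0 // ltn_mod radix_gt0.
Qed.

Lemma with_digit_lt : i < radix ns (size ns) ->
  with_digit ns i t c < radix ns (size ns).
Proof.
have PN := radix_dvd ns lt_t; have P0 := radix_gt0 t.+1 ns0.
by rewrite -(divnK PN) -!ltn_divLR // with_digit_div.
Qed.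

End WithDigit.

End MixedRadix.

(** * Hyper-hypercubes average one digit at a time *)

Section Hypercube.
Variables (R : realType) (n : nat).
Implicit Types (V : {set 'I_n}) (v : seq 'I_n).

Section Edges.
Variables (ns : seq nat) (v : seq 'I_n) (t : nat).
Hypotheses (ns0 : all (fun x => 0 < x)%N ns) (uv : uniq v).
Hypotheses (size_v : radix ns (size ns) = size v) (lt_t : (t < size ns)%N).

(** The node x belongs to its own [neighbours], since c may be its own digit. With the self-loop
    included, one step is thus the plain mean over this set. *)
Definition neighbours (x : 'I_n) : {set 'I_n} :=
  [set nth x v (with_digit ns (index x v) t c) | c : 'I_(nth 1%N ns t)].

Let idx x : x \in v -> (index x v < radix ns (size ns))%N.
Proof. by rewrite size_v index_mem. Qed.

Lemma mem_neighbours x y : x \in v ->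
  (y \in neighbours x) = (y \in v) && [forall l' : 'I_(size ns), (l' != t :> nat) ==>
    (digit ns (index x v) l' == digit ns (index y v) l')].
Proof.
move=> xv; apply/imsetP/andP => [[c _ ->]|[yv /forallP eq_xy]].
  have lt_s : (with_digit ns (index x v) t c < size v)%N.
    by rewrite -size_v with_digit_lt ?idx.
  rewrite mem_nth // index_uniq //; split=> //.
  apply/forallP => l; apply/implyP => lt; apply/eqP.
  apply: (iffRL (digits_but_one ns0 lt_t _ _)) => //; rewrite ?idx ?size_v //.
  by rewrite with_digit_mod // with_digit_div.
have [|eq_mod eq_div] := (iffLR (digits_but_one ns0 lt_t (idx xv) (idx yv))).
  by move=> l lt_l l_t; apply/eqP/(implyP (eq_xy (Ordinal lt_l))).
have lt_d : (digit ns (index y v) t < nth 1 ns t)%N.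
  by rewrite ltn_mod; move/all_nthP: ns0; apply.
exists (Ordinal lt_d) => //=.
rewrite /with_digit eq_mod eq_div -/(with_digit _ _ _ _) with_digit_id //.
by rewrite nth_index.
Qed.

Lemma neighbours_inj x : x \in v -> injective
  (fun c : 'I_(nth 1%N ns t) => nth x v (with_digit ns (index x v) t c)).
Proof.
move=> xv c d /eqP.
rewrite nth_uniq -?size_v ?with_digit_lt ?idx // => /eqP/(congr1 (divn^~ (radix ns t))).
by rewrite !with_digit_divS // => /addnI/ord_inj.
Qed.

Lemma card_neighbours x : x \in v -> #|neighbours x| = nth 1%N ns t.
Proof. by move=> xv; rewrite card_imset ?card_ord //; apply: neighbours_inj. Qed.

Lemma hyper_edgesE x y : x \in v ->
  hyper_edges R ns v t x y =
  if (y \in neighbours x) && (x != y) then (nth 1%N ns t)%:R^-1 else 0.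
Proof.
by move=> xv; rewrite mxE mem_neighbours // xv /= -andbA [in RHS](andbC _ (x != y)).
Qed.

Lemma hyper_edges_sym x y : hyper_edges R ns v t x y = hyper_edges R ns v t y x.
Proof.
rewrite !mxE (eq_sym x y) andbCA; congr (if [&& _, _, _ & _] then _ else _).
by apply: eq_forallb => l; rewrite (eq_sym (digit _ _ _)).
Qed.

Lemma nth_ns_gt0 : (0 < nth 1 ns t)%N.
Proof. by move/all_nthP: ns0; apply. Qed.

Lemma hyper_edges_graph V : v =i V -> graph_on V (hyper_edges R ns v t).
Proof.
move=> vV; split.
- exact: hyper_edges_sym.
- by move=> x y; rewrite mxE; case: ifP => // _; rewrite invr_ge0 ler0n.
- by move=> x y; rewrite -vV mxE => /negPf ->.
- move=> x; case: (boolP (x \in v)) => xv; last first.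
    by rewrite big1 ?ler01 // => y _; rewrite mxE (negPf xv).
  apply: le_trans (_ : \sum_(y in neighbours x) (nth 1%N ns t)%:R^-1 <= 1).
    rewrite [leRHS]big_mkcond /=; apply: ler_sum => y _; rewrite hyper_edgesE //.
    by case: (y \in neighbours x) => //=; case: ifP; rewrite ?invr_ge0 ?ler0n.
  rewrite sumr_const card_neighbours // -[X in X *+ _]mul1r -mulrnAl divff //.
  by rewrite pnatr_eq0 -lt0n nth_ns_gt0.
Qed.

Lemma mix_hyper_edges (z : 'I_n -> R) x : x \in v ->
  mix (hyper_edges R ns v t) z x
  = (nth 1%N ns t)%:R^-1 *
    \sum_(c < nth 1%N ns t) z (nth x v (with_digit ns (index x v) t c)).
Proof.
move=> xv; have n0 : (nth 1%N ns t)%:R != 0 :> R by rewrite pnatr_eq0 -lt0n nth_ns_gt0.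
have -> : \sum_(c < nth 1%N ns t) z (nth x v (with_digit ns (index x v) t c)) =
          \sum_(y in neighbours x) z y.
  rewrite /neighbours big_imset //= => c d _ _; exact: neighbours_inj.
rewrite /mix.
have -> : \sum_y hyper_edges R ns v t y x * (z y - z x) =
          \sum_(y in neighbours x) (nth 1%N ns t)%:R^-1 * (z y - z x).
  rewrite [RHS]big_mkcond /=; apply: eq_bigr => y _.
  rewrite hyper_edges_sym hyper_edgesE //.
  case: (y \in neighbours x); rewrite /= ?mul0r //.
  by case: eqP => [->|_] //=; rewrite subrr !mulr0.
rewrite -mulr_sumr sumrB sumr_const card_neighbours // -[z x *+ _]mulr_natr.
by rewrite mulrBr mulrCA mulVf // mulr1 addrC subrK.
Qed.

End Edges.

Lemma hyper_edges_average ns v V : all (fun x => 0 < x)%N ns -> uniq v -> v =i V ->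
  (\prod_(x <- ns) x)%N = #|V| ->
  averages V (mkseq (hyper_edges R ns v) (size ns)).
Proof.
move=> ns0 uv vV prod_ns.
have size_v : radix ns (size ns) = size v.
  by rewrite /radix take_size prod_ns -(card_uniqP uv); apply: eq_card.
have idx x : x \in v -> (index x v < radix ns (size ns))%N by rewrite size_v index_mem.
have gE E : E \in mkseq (hyper_edges R ns v) (size ns) -> graph_on V E.
  case/mapP => t; rewrite mem_iota add0n => /= lt_t ->.
  by apply: hyper_edges_graph.
split=> // z x; rewrite -vV => xv.
have const_block t : (t <= size ns)%N -> forall x y, x \in v -> y \in v ->
    (index x v %/ radix ns t = index y v %/ radix ns t)%N ->
    run (mkseq (hyper_edges R ns v) t) z x = run (mkseq (hyper_edges R ns v) t) z y.
  elim: t => [|t IHt] lt_t {xv}x y xv yv.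
    rewrite /radix take0 big_nil !divn1 => eq_xy.
    by rewrite -(nth_index x xv) eq_xy nth_index.
  (* Both sides are means over the values c of digit t. Once that digit is set to c in both indices,
     their quotients by [radix ns t] agree, so the induction hypothesis compares the two means term
     by term. *)
  move=> eq_xy; rewrite mkseqS !run_rcons !mix_hyper_edges //; congr (_ * _).
  apply: eq_bigr => c _; apply: IHt; rewrite ?mem_nth -?size_v ?with_digit_lt ?idx //.
    exact: ltnW.
  by rewrite !index_uniq -?size_v ?with_digit_lt ?idx // !with_digit_divS // eq_xy.
have const y : y \in V -> run (mkseq (hyper_edges R ns v) (size ns)) z y =
                          run (mkseq (hyper_edges R ns v) (size ns)) z x.
  by rewrite -vV => yv; apply: const_block; rewrite // !divn_small ?idx.
have V0 : #|V|%:R != 0 :> R.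
  by rewrite pnatr_eq0 -lt0n card_gt0; apply/set0Pn; exists x; rewrite -vV.
(* The final values on V are all equal; conservation of their sum identifies the common value as the
   mean. *)
rewrite -(run_sum z gE) (eq_bigr _ const) sumr_const.
by rewrite -[X in _ * X]mulr_natl mulrA mulVf ?mul1r.
Qed.

End Hypercube.

(** * Existence and length of minimal factorizations *)

Section Factorization.
Local Open Scope nat_scope.
Implicit Types (k m : nat) (ns : seq nat).

Lemma smoothP k m : 0 < m ->
  reflect (forall r, prime r -> r %| m -> r <= k.+1) (smooth k m).
Proof.
move=> m0; apply: (iffP allP) => H r; last first.
  by rewrite mem_primes => /and3P[pr _ rm]; apply: H.
by move=> pr rm; apply: H; rewrite mem_primes pr m0.
Qed.

Lemma smooth_digit k a p : 1 <= a <= k -> smooth k (a * k.+1 ^ p).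
Proof.
move=> /andP[a1 ak]; apply/smoothP => [|r pr]; first by rewrite muln_gt0 a1 expn_gt0.
rewrite Euclid_dvdM // => /orP[/(dvdn_leq a1)|]; first lia.
by case: p => [|p]; rewrite Euclid_dvdX // => /andP[/dvdn_leq-> //].
Qed.

Lemma factorization_exists k m : 0 < m -> smooth k m ->
  exists ns, factorization k m ns.
Proof.
elim/ltn_ind: m => m IHm m0 /(smoothP _ m0) sm.
have [m1|m1] := leqP m 1.
  (* A factorization is nonempty by definition, so 1 has the single factor 1. *)
  by exists [:: 1]; split; rewrite ?big_seq1 //; lia.
have pr := pdiv_prime m1; have pm := pdiv_dvd m.
have d0 : 0 < m %/ pdiv m by rewrite divn_gt0 ?pdiv_gt0 //; apply: dvdn_leq.
have [||ns [ns0 ns_prod ns_le]] := IHm (m %/ pdiv m) _ d0.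
- by rewrite ltn_Pdiv // prime_gt1.
- apply/smoothP => // r r_pr /(dvdn_trans) rd; apply: sm => //; apply: rd.
  exact: dvdn_div.
exists (pdiv m :: ns); split=> //=; first by rewrite big_cons ns_prod mulnC divnK.
by rewrite pdiv_gt0 (sm _ pr pm).
Qed.

Lemma min_factorization_exists k m : 0 < m -> smooth k m ->
  exists ns, min_factorization k m ns.
Proof.
move=> m0 /(factorization_exists m0)[ns0 ns0P].
pose P s := `[< exists2 ns, factorization k m ns & size ns = s >].
have exP : exists s, P s by exists (size ns0); apply/asboolP; exists ns0.
case: (ex_minnP exP) => s /asboolP[ns nsP <-] s_min.
by exists ns; split=> // ns' ns'P; apply: s_min; apply/asboolP; exists ns'.
Qed.

Lemma factorization_gt0 k m ns : factorization k m ns -> all (fun x => 0 < x) ns.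
Proof. by case=> _ _; apply: sub_all => x /andP[]. Qed.

Lemma factorization_leq k m ns : factorization k m ns -> m <= k.+1 ^ size ns.
Proof.
case=> _ <-; elim: ns => [|x ns IHns] /=; first by rewrite big_nil.
by move=> /andP[/andP[_ xk] /IHns]; rewrite big_cons expnS; apply: leq_mul.
Qed.

Lemma factorization_nseq k a p : 1 <= a <= k.+1 ->
  factorization k (a * k.+1 ^ p) (a :: nseq p k.+1).
Proof.
move=> ak; split=> //=; last by rewrite ak all_nseq /= leqnn orbT.
by rewrite big_cons big_nseq iter_muln_1.
Qed.

(** The lower bound holds because s factors multiply to at most (k+1)^s; the upper bound comes from
    the explicit factorization into a and p copies of k+1. *)
Lemma min_factorization_digit k a p ns : 1 <= k -> 1 <= a <= k ->
  min_factorization k (a * k.+1 ^ p) ns -> p <= size ns <= p.+1.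
Proof.
move=> k1 /andP[a1 ak] [nsP ns_min]; apply/andP; split.
  have := factorization_leq nsP => le_pow.
  by rewrite -(@leq_exp2l k.+1) //; apply: leq_trans le_pow; rewrite leq_pmull.
have ak' : 1 <= a <= k.+1 by lia.
by have := ns_min _ (factorization_nseq p ak'); rewrite /= size_nseq.
Qed.

(** For p = 0 the length is 1 rather than p, because factorizations are nonempty; hence the
    assumption [0 < p]. *)
Lemma min_factorization_pow k p ns : 1 <= k -> 0 < p ->
  min_factorization k (k.+1 ^ p) ns -> size ns = p.
Proof.
move=> k1 p0 [nsP ns_min]; apply/eqP; rewrite eqn_leq; apply/andP; split.
  have kk : 1 <= k.+1 <= k.+1 by lia.
  have := factorization_nseq p.-1 kk; rewrite -expnS prednK // => /ns_min.
  by rewrite /= size_nseq prednK.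
by rewrite -(@leq_exp2l k.+1) // (factorization_leq nsP).
Qed.

(* Two factors whose squares are at most k+1 could be merged into one, so all
   factors but one exceed the square root of k+1. *)
Lemma min_factorization_size k m ns : min_factorization k m ns ->
  k.+1 ^ (size ns).-1 <= m ^ 2.
Proof.
move=> [[ns0 ns_prod ns_le] ns_min].
pose small x := x * x <= k.+1.
have perm_ns := permEl (perm_filterC small ns).
have size_ns := perm_size perm_ns; rewrite size_cat in size_ns.
(* The product of two small factors is at most the square of the larger one, hence at most k+1;
   merging them would give a shorter factorization. *)
have small1 : size (filter small ns) <= 1.
  have : all small (filter small ns) by apply: filter_all.
  case def_s: (filter small ns) => [|a [|b s]] //= /and3P[sa sb _].
  move: perm_ns; rewrite def_s; set s2 := filter (predC small) ns => perm_ns.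
  suff : factorization k m ((a * b) :: s ++ s2).
    by move/ns_min; rewrite -(perm_size perm_ns) /= ltnn.
  split=> //.
    by rewrite -ns_prod -(perm_big _ perm_ns) /= !big_cons mulnA.
  move: ns_le; rewrite -(perm_all _ perm_ns) /= => /and3P[a1 b1 ->].
  move: sa sb a1 b1; rewrite /small andbT => sa sb /andP[a1 _] /andP[b1 _].
  rewrite muln_gt0 a1 b1 /=; case: (leqP a b) => ab.
    by apply: leq_trans sb; rewrite leq_mul2r ab orbT.
  by apply: leq_trans sa; rewrite leq_mul2l (ltnW ab) orbT.
move: perm_ns small1 size_ns (filter_all (predC small) ns).
move: (filter small ns) (filter (predC small) ns) => s1 s2 perm_ns small1 size_ns big2.
have m_ge : \prod_(x <- s2) x <= m.
  rewrite -ns_prod -(perm_big _ perm_ns) /= big_cat /= leq_pmull //.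
  move: ns_le; rewrite -(perm_all _ perm_ns) all_cat => /andP[/allP s1P _].
  by rewrite big_seq; apply: prodn_cond_gt0 => x /s1P/andP[].
(* Only the factors whose squares exceed k+1 are kept. At most one factor is lost, which accounts
   for the [.-1] in the exponent. *)
apply: (@leq_trans ((\prod_(x <- s2) x) ^ 2)); last by rewrite leq_exp2r.
apply: (@leq_trans (k.+1 ^ size s2)); first apply: leq_pexp2l => //.
  by rewrite -size_ns; case: (size s1) small1 => [|[|]] // _; apply: leq_pred.
elim: s2 big2 {perm_ns size_ns m_ge} => [|x s2 IHs2] /=; first by rewrite big_nil.
move=> /andP[xk /IHs2]; rewrite big_cons expnMn (expnS k.+1); apply: leq_mul.
by move: xk; rewrite /small -ltnNge -mulnn => /ltnW.
Qed.

End Factorization.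

Section HyperHypercube.
Variables (R : realType) (n k : nat).
Implicit Types (V : {set 'I_n}) (S : seq 'M[R]_n).

Lemma hyper_hypercube_average V S : hyper_hypercube k V S -> averages V S.
Proof.
case=> ns [v [[nsP _] uv vV ->]]; apply: hyper_edges_average => //.
  exact: factorization_gt0 nsP.
by case: nsP.
Qed.

Lemma hyper_hypercube_size V S : hyper_hypercube k V S ->
  exists2 ns, min_factorization k #|V| ns & size S = size ns.
Proof. by case=> ns [v [nsP _ _ ->]]; exists ns; rewrite ?size_mkseq. Qed.

Lemma hyper_hypercube_size_gt0 V S : hyper_hypercube k V S -> (0 < size S)%N.
Proof. by case/hyper_hypercube_size => ns [[ns0 _ _] _] ->. Qed.

Lemma hyper_hypercube_exists V : (0 < #|V|)%N -> smooth k #|V| ->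
  exists S, hyper_hypercube k V S.
Proof.
move=> V0 /(min_factorization_exists V0)[ns nsP].
exists (mkseq (hyper_edges R ns (enum V)) (size ns)), ns, (enum V).
by split; rewrite ?enum_uniq // => x; rewrite mem_enum.
Qed.

End HyperHypercube.

(** * The Simple Base-(k+1) Graph *)

Section Splits.
Variables (n : nat) (V : {set 'I_n}) (L : nat).
Variables (Vs : nat -> {set 'I_n}) (c : nat -> nat).
Hypothesis sV : splits V L Vs c.

Lemma splits_sub l : (1 <= l <= L)%N -> Vs l \subset V.
Proof.
move=> lL; apply/subsetP => x xl; have [-> _ _] := sV.
by apply/bigcup_natP; exists l.
Qed.

Lemma splits_mem x : x \in V -> exists2 l, (1 <= l <= L)%N & x \in Vs l.
Proof. by have [-> _ _] := sV => /bigcup_natP. Qed.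

Lemma splits_inj x l l' : (1 <= l <= L)%N -> (1 <= l' <= L)%N ->
  x \in Vs l -> x \in Vs l' -> l = l'.
Proof.
move=> lL lL' xl xl'; apply/eqP; apply: contraLR xl' => ll'.
by have [_ dV _] := sV; rewrite (disjointFr (dV _ _ _ _ ll') xl).
Qed.

Lemma splits_notin x l l' : (1 <= l <= L)%N -> (1 <= l' <= L)%N ->
  x \in Vs l -> l != l' -> x \notin Vs l'.
Proof.
by move=> lL lL' xl; apply: contraNN => xl'; rewrite (splits_inj lL lL' xl xl').
Qed.

Lemma sum_splits (R : nmodType) (f : 'I_n -> R) :
  \sum_(x in V) f x = \sum_(1 <= l < L.+1) \sum_(x in Vs l) f x.
Proof.
transitivity (\sum_(1 <= l < L.+1) \sum_(x in V | x \in Vs l) f x); last first.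
  rewrite !big_nat; apply: eq_bigr => l /splits_sub/subsetP sl.
  apply: eq_bigl => x; case: (boolP (x \in Vs l)) => [/sl ->|] //; by rewrite andbF.
rewrite (exchange_big_dep (mem V)) /= => [|l y _ /andP[] //].
apply: eq_bigr => x xV; have [l lL xl] := splits_mem xV.
have perm_l : perm_eq
    [seq i <- index_iota 1 L.+1 | (x \in V) && (x \in Vs i)] [:: l].
  apply: uniq_perm; rewrite ?filter_uniq ?iota_uniq // => l'.
  rewrite mem_filter mem_index_iota inE xV /=; apply/andP/eqP => [[xl' lL']|->] //.
  exact: splits_inj xl' xl.
by rewrite -big_filter (perm_big _ perm_l) big_seq1.
Qed.

Lemma splits_card : #|V| = (\sum_(1 <= l < L.+1) c l)%N.
Proof.
rewrite -sum1_card sum_splits !big_nat; apply: eq_bigr => l lL.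
by have [_ _ cV] := sV; rewrite sum1_card cV.
Qed.

Variable (R : realType).
Implicit Types D : nat -> 'M[R]_n.

(** A column indexed by a node of block l only sees the graph of that block. The bound t may stop
    before L because a crossing round runs the inner graphs of the first blocks only. *)
Lemma sum_graph_in D t l x y : (1 <= l < t)%N -> (t <= L.+1)%N ->
  (forall l', (1 <= l' < t)%N -> graph_on (Vs l') (D l')) ->
  y \in Vs l -> (\sum_(1 <= l' < t) D l') x y = D l x y.
Proof.
move=> lt tL gD yl; rewrite summxE (bigD1_seq l) /= ?iota_uniq ?mem_index_iota //.
rewrite big_seq_cond big1 ?addr0 // => l'; rewrite mem_index_iota => /andP[lt' ll'].
apply: (graph_supp_r x (gD _ lt')).
by apply: (@splits_notin _ l); rewrite 1?eq_sym //; lia.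
Qed.

Lemma sum_graph_out D t x y : 
  (forall l', (1 <= l' < t)%N -> graph_on (Vs l') (D l')) ->
  (forall l', (1 <= l' < t)%N -> y \notin Vs l') ->
  (\sum_(1 <= l' < t) D l') x y = 0.
Proof.
move=> gD yV; rewrite summxE big_nat big1 // => l lt.
exact: graph_supp_r (gD _ lt) (yV _ lt).
Qed.

Lemma graph_on_splits D t : (t <= L.+1)%N ->
  (forall l, (1 <= l < t)%N -> graph_on (Vs l) (D l)) ->
  graph_on V (\sum_(1 <= l < t) D l).
Proof.
move=> tL gD; apply: graph_on_sum gD _ _ => [l lt|l l' lt lt' ll'].
  by apply: splits_sub; lia.
by have [_ dV _] := sV; apply: dV => //; lia.
Qed.

End Splits.

Section Cyclic.
Variables (R : realType) (n : nat) (U : {set 'I_n}) (S : seq 'M[R]_n).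
Hypotheses (avS : averages U S) (S0 : (0 < size S)%N).

Lemma cyc_graph i : graph_on U (cyc S i).
Proof. by have [gS _] := avS; apply: gS; rewrite mem_nth // ltn_mod. Qed.

(** One full pass makes the values on U constant, and further repetitions preserve constants. This
    lets a short sequence run alongside longer ones. *)
Lemma cyc_average M : (size S <= M)%N ->
  averages U (mkseq (fun i => cyc S i.+1) M).
Proof.
move=> SM; split=> [E /mapP[i _ ->]|x v vU]; first exact: cyc_graph.
have -> : mkseq (fun i => cyc S i.+1) M =
          S ++ drop (size S) (mkseq (fun i => cyc S i.+1) M).
  rewrite -{1}[LHS](cat_take_drop (size S)); congr (_ ++ _).
  apply: (@eq_from_nth _ 0) => [|i]; rewrite size_takel ?size_mkseq //.
  by move=> iS; rewrite nth_take // nth_mkseq ?(leq_trans iS) // /cyc /= modn_small.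
rewrite run_cat.
apply: (@run_const _ _ U) => // [E u i /mem_drop/mapP[t _ ->] uU iU|u uU].
  exact: graph_supp (cyc_graph _) _ _ iU.
by have [_ ->] := avS.
Qed.

End Cyclic.

(** * Grouping isolated nodes into cliques *)

Section Group.
Variables (R : realType) (n k : nat) (U : {set 'I_n}).
Implicit Types (E F : 'M[R]_n) (W : {set 'I_n}).

Lemma isolatedP E x : reflect (forall y, E x y = 0) (x \in isolated E).
Proof.
by rewrite inE; apply: (iffP forallP) => H y; [apply/eqP | rewrite H].
Qed.

Lemma clique_graph W : graph_on W (clique R W).
Proof.
split.
- by move=> i j; rewrite !mxE eq_sym andbCA.
- by move=> i j; rewrite mxE; case: ifP => // _; rewrite invr_ge0 ler0n.
- by move=> i j /negPf iW; rewrite mxE iW.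
- move=> i; case: (boolP (i \in W)) => iW; last first.
    by rewrite big1 ?ler01 // => j _; rewrite mxE (negPf iW).
  apply: le_trans (_ : \sum_(j in W) #|W|%:R^-1 <= 1).
    rewrite [leRHS]big_mkcond; apply: ler_sum => j _; rewrite mxE iW /=.
    by case: (j \in W) => //=; case: ifP; rewrite ?invr_ge0 ?ler0n.
  have W0 : #|W|%:R != 0 :> R.
    by rewrite pnatr_eq0 -lt0n card_gt0; apply/set0Pn; exists i.
  by rewrite sumr_const -[X in X *+ _]mul1r -mulrnAl divff.
Qed.

(* Grouping only joins nodes that had no edge, so the row sums stay below 1. *)
Lemma group_isolated_graph W E E' : U \subset W ->
  group_isolated k U E E' -> graph_on W E ->
  graph_on W E' /\ forall i j, ~~ ((i \in U) && (j \in U)) -> E' i j = E i j.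
Proof.
move=> sUW; elim=> {E E'} [//|W' E E' _ sW' _ _ IH gE].
have sW'U : W' \subset U by apply: subset_trans sW' (subsetIl _ _).
have gC := clique_graph W'.
have gEC : graph_on W (E + clique R W').
  split=> [i j|i j|i j iW|i].
  - by rewrite !mxE -[E i j](graph_sym gE) eq_sym andbCA.
  - by rewrite mxE addr_ge0 ?(graph_ge0 gE) ?(graph_ge0 gC).
  - rewrite mxE (graph_supp gE) // (graph_supp gC) ?addr0 //.
    by apply: contra iW => /(subsetP sW'U)/(subsetP sUW).
  - case: (boolP (i \in W')) => iW'.
      have /isolatedP iE : i \in isolated E by have /setIP[] := subsetP sW' _ iW'.
      by under eq_bigr => j _ do rewrite mxE iE add0r; apply: graph_row gC i.
    by under eq_bigr => j _ do rewrite mxE (graph_supp gC) // addr0;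
      apply: graph_row gE i.
have [gE' eqE'] := IH gEC; split=> // i j ij.
rewrite eqE' // !mxE; case: ifP; rewrite ?addr0 // => /and3P[iW' jW' _].
by rewrite (subsetP sW'U i iW') (subsetP sW'U j jW') in ij.
Qed.

Lemma subset_of_card (T : finType) (A : {set T}) d : (d <= #|A|)%N ->
  exists2 B : {set T}, B \subset A & #|B| = d.
Proof.
move=> dA; exists [set x in take d (enum A)].
  by apply/subsetP => x; rewrite inE => /mem_take; rewrite mem_enum.
rewrite cardsE; have /card_uniqP -> : uniq (take d (enum A)).
  by rewrite take_uniq ?enum_uniq.
by rewrite size_takel // -cardE.
Qed.

(** Since [0 < k], every selected clique has at least two nodes, and its weights are nonzero; so its
    nodes stop being isolated and the number of isolated nodes of U strictly decreases. *)
Lemma group_isolated_exists E : (0 < k)%N -> exists E', group_isolated k U E E'.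
Proof.
move=> k0; move def_c: #|U :&: isolated E| => d.
elim/ltn_ind: d E def_c => d IHd E def_d.
have [d2|d2] := ltnP d 2; first by exists E; apply: Group_stop; rewrite def_d.
have [W sW cW] : exists2 W : {set 'I_n}, W \subset U :&: isolated E & #|W| = minn k.+1 d.
  by apply: subset_of_card; rewrite def_d geq_minr.
have W2 : (1 < #|W|)%N by rewrite cW leq_min d2 ltnS k0.
have lt_d : (#|U :&: isolated (E + clique R W)| < d)%N.
  rewrite -def_d; apply: proper_card; apply/properP.
  have W_iso x : x \in W -> x \notin isolated (E + clique R W).
    move=> xW; have [y] : exists y, y \in W :\ x.
      by apply/set0Pn; rewrite -card_gt0; rewrite (cardsD1 x) xW in W2.
    rewrite in_setD1 => /andP[yx yW]; apply/isolatedP => /(_ y).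
    have /setIP[_ /isolatedP xE] := subsetP sW _ xW.
    rewrite !mxE xE xW yW eq_sym yx add0r /= => /eqP.
    by rewrite invr_eq0 pnatr_eq0 => /eqP W0; rewrite W0 in W2.
  split.
    apply/subsetP => x /setIP[xU xi]; rewrite inE xU /=; apply/isolatedP => y.
    have xW : x \notin W by apply: contraL xi => /W_iso.
    by move/isolatedP: xi => /(_ y); rewrite !mxE (negPf xW) addr0.
  have [x xW] : exists x, x \in W by apply/set0Pn; rewrite -card_gt0 ltnW.
  by exists x; rewrite ?(subsetP sW) // inE negb_and W_iso ?orbT.
have [E' gE'] := IHd _ lt_d _ erefl.
by exists E'; apply: Group_step gE'; rewrite ?def_d.
Qed.

End Group.

(** * Arithmetic of the base-(k+1) splitting *)

Section Splitting.
Variables (R : realType) (n k : nat) (V : {set 'I_n}) (s : splitting R n).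
Hypotheses (k1 : (1 <= k)%N) (vs : valid_splitting k V s) (L2 : (1 < sL s)%N).
Implicit Types (E F : 'M[R]_n) (P : {set 'I_n}) (j l c m : nat).

Let Vsplit := vs_V vs.

Lemma sV_card l : (1 <= l <= sL s)%N -> #|sV s l| = (sa s l * k.+1 ^ sp s l)%N.
Proof. by have [_ _] := Vsplit; apply. Qed.

Lemma sVV_card l c : (1 <= l <= sL s)%N -> (1 <= c <= sa s l)%N ->
  #|sVV s l c| = (k.+1 ^ sp s l)%N.
Proof. by move=> lL; have [_ _] := vs_VV vs lL; apply. Qed.

Lemma sV_gt0 l : (1 <= l <= sL s)%N -> (0 < #|sV s l|)%N.
Proof.
by move=> lL; rewrite sV_card // muln_gt0 expn_gt0; have /andP[->] := vs_dig vs lL.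
Qed.

Lemma sVV_sub l c x : (1 <= l <= sL s)%N -> (1 <= c <= sa s l)%N ->
  x \in sVV s l c -> x \in sV s l.
Proof. by move=> lL /(splits_sub (vs_VV vs lL))/subsetP; apply. Qed.

(** Strictly decreasing exponents lose at least 1 per index. This is the count of rounds left for
    the inner averaging of V_l after round m1 + l. *)
Lemma sp_add_leq l : (1 <= l <= sL s)%N -> (sp s l + l <= sp s 1 + 1)%N.
Proof.
elim: l => [|[|l] IHl] // lL.
have lL' : (1 <= l.+1 <= sL s)%N by lia.
have lt1 : (0 < l.+1)%N by []. have lt2 : (l.+1 < l.+2)%N by [].
have lt3 : (l.+2 <= sL s)%N by lia.
have := vs_pow vs lt1 lt2 lt3; have := IHl lL'; lia.
Qed.

Lemma sp_gt0 l : (1 <= l < sL s)%N -> (0 < sp s l)%N.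
Proof.
by move=> /andP[l1 lL]; apply: leq_ltn_trans (vs_pow vs l1 lL (leqnn _)).
Qed.

Definition tail j : {set 'I_n} := \bigcup_(j <= l < (sL s).+1) sV s l.

Definition tail_card j := (\sum_(j <= l < (sL s).+1) #|sV s l|)%N.

Lemma tailP j x : reflect (exists2 l, (j <= l <= sL s)%N & x \in sV s l) (x \in tail j).
Proof. exact: (bigcup_natP (sV s) j (sL s).+1). Qed.

Lemma tail_recl j : (j <= sL s)%N -> tail j = sV s j :|: tail j.+1.
Proof. by move=> jL; rewrite /tail big_ltn. Qed.

Lemma tail_card_recl j : (j <= sL s)%N -> tail_card j = (#|sV s j| + tail_card j.+1)%N.
Proof. by move=> jL; rewrite /tail_card big_ltn. Qed.

Lemma sV_notin_tail j l x : (1 <= l)%N -> (l < j)%N -> x \in sV s l -> x \notin tail j.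
Proof.
move=> l1 lj xl; apply/tailP => -[l' lL' xl'].
have ll : l = l' by apply: (splits_inj Vsplit) xl xl'; lia.
by lia.
Qed.

Lemma card_tail j : (1 <= j)%N -> #|tail j| = tail_card j.
Proof.
move=> j1; have [jL|jL] := ltnP (sL s) j.
  by rewrite /tail /tail_card !big_geq ?cards0.
move dj: (sL s - j)%N => d; elim: d j j1 jL dj => [|d IHd] j j1 jL dj;
  rewrite (tail_recl jL) (tail_card_recl jL).
  have -> : j = sL s by lia.
  by rewrite /tail /tail_card !big_geq // setU0 addn0.
have jL' : (j.+1 <= sL s)%N by lia.
have dj' : (sL s - j.+1 = d)%N by lia.
rewrite -(IHd j.+1 isT jL' dj').
apply/eqP; rewrite (leq_card_setU (sV s j) (tail j.+1)).2 disjoint_subset.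
by apply/subsetP => x /(sV_notin_tail j1 (ltnSn j)).
Qed.

(** Lower digits never reach the next power of the base: by induction the part after j+1 is below
    (k+1)^(p_(j+1)), and a_(j+1) <= k further copies of this power give at most (k+1)^(p_(j+1) + 1)
    <= (k+1)^(p_j). *)
Lemma tail_card_lt j : (1 <= j <= sL s)%N -> (tail_card j.+1 < k.+1 ^ sp s j)%N.
Proof.
move=> /andP[j1 jL]; move dj: (sL s - j)%N => d.
elim: d j j1 jL dj => [|d IHd] j j1 jL dj.
  by rewrite /tail_card big_geq ?expn_gt0 //; lia.
have jL' : (1 <= j.+1 <= sL s)%N by lia.
have lt_tail : (tail_card j.+2 < k.+1 ^ sp s j.+1)%N by apply: IHd; lia.
have /andP[_ ak] := vs_dig vs jL'.
have p_lt : (sp s j.+1 < sp s j)%N by apply: (vs_pow vs); lia.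
have /andP[_ jL1] := jL'; rewrite tail_card_recl // sV_card //.
apply: (@leq_trans (k.+1 ^ (sp s j.+1).+1)); last exact: leq_pexp2l.
rewrite expnS mulSn addnC -addSn; apply: leq_add => //.
by rewrite leq_mul2r ak orbT.
Qed.

Lemma link_weightE j :
  link_weight s j = #|sV s j|%:R / ((sa s j)%:R * (tail_card j)%:R).
Proof. by rewrite /link_weight natrM. Qed.

(** * Linking the later sets to the blocks of V_j *)

Section Link.
Variable j : nat.
Hypothesis jL : (1 <= j < sL s)%N.
Let jL' : (1 <= j <= sL s)%N. Proof. by lia. Qed.
Notation w := (link_weight s j).

Lemma sa_gt0 : 0 < (sa s j)%:R :> R.
Proof. by rewrite ltr0n; have /andP[] := vs_dig vs jL'. Qed.

Lemma tail_card_gt0 : 0 < (tail_card j)%:R :> R.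
Proof. by rewrite ltr0n tail_card_recl ?addn_gt0 ?sV_gt0 //; lia. Qed.

Lemma link_weight_gt0 : 0 < w.
Proof.
by rewrite link_weightE divr_gt0 ?mulr_gt0 ?sa_gt0 ?tail_card_gt0 // ltr0n sV_gt0.
Qed.

Lemma sa_link_weight : (sa s j)%:R * w = #|sV s j|%:R / (tail_card j)%:R.
Proof.
rewrite link_weightE; have := sa_gt0; have := tail_card_gt0.
by move=> /lt0r_neq0 t0 /lt0r_neq0 a0; field; rewrite t0 a0.
Qed.

(** This quantity is the full row sum of a linked node outside V_j, which has one edge into each of
    the a_j blocks. *)
Lemma sa_link_weight_le1 : (sa s j)%:R * w <= 1.
Proof.
rewrite sa_link_weight ler_pdivrMr ?tail_card_gt0 // mul1r ler_nat.
by rewrite tail_card_recl ?leq_addr //; lia.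
Qed.

Lemma link_weight_le1 : w <= 1.
Proof.
apply: le_trans sa_link_weight_le1; rewrite ler_peMl ?(ltW link_weight_gt0) //.
by rewrite ler1n; have /andP[] := vs_dig vs jL'.
Qed.

(* The state of round m1 + j once the nodes of P have been linked. *)
Record linked P E : Prop := Linked {
  linked_sym : forall x y, E x y = E y x;
  linked_ge0 : forall x y, 0 <= E x y;
  linked_row : forall u, u \in sV s j -> \sum_y E u y <= w;
  linked_sum : forall v c, v \in P -> (1 <= c <= sa s j)%N ->
    \sum_(u in sVV s j c) E u v = w;
  linked_cross : forall x y, x \notin sV s j -> y \notin sV s j -> E x y = 0;
  linked_supp : forall x y, x \notin sV s j -> x \notin P -> E x y = 0;
  linked_free : forall c, (1 <= c <= sa s j)%N ->
    (#|sVV s j c| <= #|sVV s j c :&: isolated E| + #|P|)%N }.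

Lemma linked0 : linked set0 0.
Proof.
split=> [x y|x y|u _|v c|x y _ _|x y _ _|c _]; rewrite ?mxE ?inE //.
  by rewrite big1 ?(ltW link_weight_gt0) // => y _; rewrite mxE.
rewrite (_ : isolated 0 = setT) ?setIT ?leq_addr //.
by apply/setP => x; rewrite [RHS]inE; apply/isolatedP => y; rewrite mxE.
Qed.

Section Star.
Variables (v : 'I_n) (u : nat -> 'I_n) (P : {set 'I_n}) (E : 'M[R]_n).
Hypotheses (vP : v \notin P) (vV : v \notin sV s j) (lE : linked P E).
Hypothesis uE : forall c, (1 <= c <= sa s j)%N -> u c \in sVV s j c :&: isolated E.

(** The weight that y receives from v. The blocks are disjoint, so at most one term is nonzero and
    the value is [w] or 0. *)
Let mult (y : 'I_n) : R := \sum_(1 <= c < (sa s j).+1) (if y == u c then w else 0).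
Let star : 'M[R]_n := \sum_(1 <= c < (sa s j).+1) edge v (u c) w.

Let uV c : (1 <= c <= sa s j)%N -> u c \in sV s j.
Proof. by move=> ca; have /setIP[/(sVV_sub jL' ca)] := uE ca. Qed.

Let multE y c : (1 <= c <= sa s j)%N -> y \in sVV s j c ->
  mult y = if y == u c then w else 0.
Proof.
move=> ca yc; rewrite /mult (bigD1_seq c) ?mem_index_iota ?iota_uniq //=.
rewrite big_seq_cond big1 ?addr0 // => c'; rewrite mem_index_iota => /andP[ca' cc'].
case: eqP => // yu; have /setIP[yc' _] := uE ca'; rewrite -yu in yc'.
by rewrite (splits_inj (vs_VV vs jL') ca ca' yc yc') eqxx in cc'.
Qed.

Let mult_out y : y \notin sV s j -> mult y = 0.
Proof.
move=> yV; rewrite /mult big_nat big1 // => c ca; case: eqP => // yu.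
by rewrite yu uV in yV.
Qed.

Let starE x y : star x y = if x == v then mult y else if y == v then mult x else 0.
Proof.
rewrite /star summxE; have uv c : (1 <= c <= sa s j)%N -> (u c == v) = false.
  by move=> ca; apply: contraNF vV => /eqP <-; apply: uV.
have [->|xv] := eqVneq x v.
  rewrite /mult !big_nat; apply: eq_bigr => c ca.
  by rewrite mxE eqxx /= [v == u c]eq_sym uv //= orbF.
have [->|yv] := eqVneq y v.
  rewrite /mult !big_nat; apply: eq_bigr => c ca.
  by rewrite mxE (negPf xv) eqxx /= andbT.
by rewrite big_nat big1 // => c ca; rewrite mxE (negPf xv) (negPf yv) andbF.
Qed.

Let mult_ge0 y : 0 <= mult y.
Proof. by apply: sumr_ge0 => c _; case: ifP; rewrite ?(ltW link_weight_gt0). Qed.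

Let mult_sum c : (1 <= c <= sa s j)%N -> \sum_(y in sVV s j c) mult y = w.
Proof.
move=> ca; have /setIP[uc _] := uE ca.
rewrite (eq_bigr (fun y => if y == u c then w else 0)) => [|y yc]; last exact: multE.
rewrite (bigD1 (u c)) //= eqxx big1 ?addr0 // => y /andP[_ /negPf ->]; done.
Qed.

Let mult_neq0 y : mult y != 0 -> (y \in isolated E) && (mult y == w).
Proof.
move=> y0; have yV : y \in sV s j by apply: contraNT y0 => /mult_out ->.
have [c ca yc] := splits_mem (vs_VV vs jL') yV.
move: y0; rewrite (multE ca yc); have [yu _|_] := eqVneq y (u c); last by rewrite eqxx.
by have /setIP[_ ] := uE ca; rewrite yu eqxx andbT.
Qed.

(** Each [u c] was isolated, so its old row is zero and its new row sums to exactly [w]. In each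
    block only [u c] stops being isolated while P gains v, so the balance in [linked_free] is
    kept. *)
Lemma linked_star : linked (v |: P) (E + star).
Proof.
have vj u' : u' \in sV s j -> (u' == v) = false.
  by move=> u'j; apply: contraNF vV => /eqP <-.
split.
- move=> x y; rewrite !mxE (linked_sym lE) !starE.
  by have [->|xv] := eqVneq x v; have [->|yv] := eqVneq y v.
- move=> x y; rewrite mxE addr_ge0 ?(linked_ge0 lE) // starE.
  by case: ifP => _ //; case: ifP.
- move=> u' u'j; under eq_bigr => y _ do rewrite mxE starE vj //.
  rewrite big_split /= -big_mkcond /= big_pred1_eq.
  have [->|/mult_neq0/andP[/isolatedP u'E /eqP ->]] := eqVneq (mult u') 0.
    by rewrite addr0 (linked_row lE).
  by rewrite big1 ?add0r // => y _.
- move=> v' c; rewrite in_setU1 => v'P ca.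
  under eq_bigr => u' u'c do rewrite mxE starE vj ?(sVV_sub jL' ca) //.
  rewrite big_split /=; case/predU1P: v'P => [->|v'P].
    rewrite eqxx mult_sum // big1 ?add0r // => u' _.
    by rewrite (linked_sym lE) (linked_supp lE).
  rewrite (linked_sum lE) // big1 ?addr0 // => u' _.
  by case: eqP => // v'v; rewrite v'v (negPf vP) in v'P.
- move=> x y xj yj; rewrite mxE (linked_cross lE) // starE !mult_out //.
  by rewrite !if_same addr0.
- move=> x y xj; rewrite in_setU1 negb_or => /andP[xv xP].
  rewrite mxE (linked_supp lE) // starE (negPf xv) mult_out //.
  by rewrite if_same addr0.
- move=> c ca; apply: leq_trans (linked_free lE ca) _.
  rewrite cardsU1 vP addnCA addnA leq_add2r.
  rewrite (cardsD1 (u c)) uE //; rewrite leq_add2l; apply: subset_leq_card.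
  apply/subsetP => y; rewrite !in_setD1 !in_setI => /and3P[yu yc yE].
  rewrite yc; apply/isolatedP => z; move/isolatedP: yE => yE.
  rewrite mxE yE add0r starE vj ?(sVV_sub jL' ca) // (multE ca yc) (negPf yu).
  by case: ifP.
Qed.

End Star.

Lemma link_linked ws E E' P : link s j ws E E' -> uniq ws ->
  (forall x, x \in ws -> (x \notin P) && (x \notin sV s j)) ->
  linked P E -> linked (P :|: [set x in ws]) E'.
Proof.
move=> lk; elim: lk P => {ws E E'} [E|v ws u E E' uE _ IH] P /= uws wsP lE.
  by rewrite (_ : [set x in [::]] = set0) ?setU0 //; apply/setP => x; rewrite !inE.
have /andP[vP vV] := wsP v (mem_head _ _); have /andP[vws uws'] := uws.
rewrite set_cons setUCA setUA; apply: IH => // [x xws|]; last exact: linked_star.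
have /andP[xP xV] := wsP x (mem_behead (s := v :: ws) xws).
rewrite in_setU1 negb_or xP xV !andbT.
by apply: contraNneq vws => <-.
Qed.

Lemma link_exists ws E P : uniq ws ->
  (forall x, x \in ws -> (x \notin P) && (x \notin sV s j)) ->
  (#|P| + size ws < k.+1 ^ sp s j)%N ->
  linked P E -> exists E', link s j ws E E'.
Proof.
elim: ws E P => [|v ws IHws] E P /= uws wsP cP lE.
  by exists E; apply: Link_nil.
have /andP[vP vV] := wsP v (mem_head _ _); have /andP[vws uws'] := uws.
(* By [linked_free] a block still has at least its size minus #|P| isolated nodes, and the size
   bound makes this positive. Outside the range of c the default node v is harmless. *)
have /choice[u uE] c : exists u, (1 <= c <= sa s j)%N -> u \in sVV s j c :&: isolated E.
  have [ca|] := boolP (1 <= c <= sa s j)%N; last by exists v.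
  have := linked_free lE ca; rewrite sVV_card // => cP'.
  have : (0 < #|sVV s j c :&: isolated E|)%N.
    rewrite lt0n; apply: contraTneq cP' => ->.
    by rewrite -ltnNge add0n (leq_ltn_trans _ cP) // leq_addr.
  by rewrite card_gt0 => /set0Pn[u uP]; exists u.
have lE' := linked_star vP vV lE uE.
have [||E' lk] := IHws _ _ uws' _ _ lE'.
- move=> x xws; have /andP[xP xV] := wsP x (mem_behead (s := v :: ws) xws).
  rewrite in_setU1 negb_or xP xV !andbT.
  by apply: contraNneq vws => <-.
- by rewrite cardsU1 vP add1n addSnnS.
- by exists E'; apply: Link_cons lk.
Qed.

(** A node of V_j has total weight at most [w], and a linked node has total weight a_j [w] = N_j /
    T_j; both are at most 1. *)
Lemma linked_graph P E : P \subset tail j.+1 -> linked P E -> graph_on (tail j) E.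
Proof.
move=> sP lE; have tj : tail j = sV s j :|: tail j.+1 by apply: tail_recl; lia.
split.
- exact: linked_sym lE.
- exact: linked_ge0 lE.
- move=> x y; rewrite tj in_setU negb_or => /andP[xj xt].
  by apply: (linked_supp lE) => //; apply: contra xt; apply: subsetP.
- move=> x; case: (boolP (x \in sV s j)) => xj.
    exact: le_trans (linked_row lE xj) link_weight_le1.
  case: (boolP (x \in P)) => xP; last first.
    by rewrite big1 ?ler01 // => y _; rewrite (linked_supp lE).
  rewrite (bigID (mem (sV s j))) /= [X in _ + X]big1 ?addr0 => [|y yj]; last first.
    exact: (linked_cross lE).
  apply: le_trans sa_link_weight_le1.
  rewrite (sum_splits (vs_VV vs jL')) (eq_big_nat _ _ (F2 := fun=> w)) => [|c ca].
    by rewrite sumr_const_nat subSS subn0 mulr_natl.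
  by under eq_bigr => y _ do rewrite (linked_sym lE); rewrite (linked_sum lE).
Qed.

(* The edges produced in round m1 + j by the passes l >= j. *)
Record crossing F : Prop := Crossing {
  crossing_graph : graph_on (tail j) F;
  crossing_sum : forall v c, v \in tail j.+1 -> (1 <= c <= sa s j)%N ->
    \sum_(u in sVV s j c) F u v = w;
  crossing_supp : forall x v, v \in tail j.+1 -> x \notin sV s j -> F x v = 0 }.

(** Grouping alters only entries with both ends in V_j, so the columns of the later sets are as the
    linking left them. *)
Lemma group_crossing E F : linked (tail j.+1) E -> group_isolated k (sV s j) E F ->
  crossing F.
Proof.
move=> lE gF; have gE := linked_graph (subxx _) lE.
have tj : tail j = sV s j :|: tail j.+1 by apply: tail_recl; lia.
have sj : sV s j \subset tail j by rewrite tj subsetUl.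
have [gF' eqF] := group_isolated_graph sj gF gE.
have tV v : v \in tail j.+1 -> v \notin sV s j.
  by apply: contraL => vj; apply: sV_notin_tail vj; lia.
have eqFv x v : v \in tail j.+1 -> F x v = E x v.
  by move=> /tV vj; rewrite eqF // (negPf vj) andbF.
split=> // [v c vt ca|x v vt xj].
  by rewrite -(linked_sum lE vt ca); apply: eq_bigr => x _; apply: eqFv.
by rewrite eqFv // (linked_cross lE) // tV.
Qed.

End Link.

(** * The edge set produced by each round, and termination of the loop *)

Notation m1 := (size (sH s 1)).

Lemma sH_average l : (1 <= l <= sL s)%N -> averages (sV s l) (sH s l).
Proof. by move=> lL; apply: hyper_hypercube_average (vs_H vs lL). Qed.

Lemma sH_size_gt0 l : (1 <= l <= sL s)%N -> (0 < size (sH s l))%N.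
Proof. by move=> lL; apply: hyper_hypercube_size_gt0 (vs_H vs lL). Qed.

Lemma sHH_average l c : (1 <= l <= sL s)%N -> (1 <= c <= sa s l)%N ->
  averages (sVV s l c) (sHH s l c).
Proof. by move=> lL ca; apply: hyper_hypercube_average (vs_HH vs lL ca). Qed.

Lemma sHH_size_gt0 l c : (1 <= l <= sL s)%N -> (1 <= c <= sa s l)%N ->
  (0 < size (sHH s l c))%N.
Proof. by move=> lL ca; apply: hyper_hypercube_size_gt0 (vs_HH vs lL ca). Qed.

Definition inner l i : 'M[R]_n :=
  if sp s l != 0%N then \sum_(1 <= c < (sa s l).+1) cyc (sHH s l c) i
  else cyc (sH s l) i.

Lemma inner_graph l i : (1 <= l <= sL s)%N -> graph_on (sV s l) (inner l i).
Proof.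
move=> lL; rewrite /inner; case: ifP => _; last first.
  exact: cyc_graph (sH_average lL) (sH_size_gt0 lL) _.
apply: (graph_on_splits (vs_VV vs lL)) => // c ca.
exact: cyc_graph (sHH_average lL ca) (sHH_size_gt0 lL ca) _.
Qed.

(** For l < L the exponent p_l is positive, so the branch that works block by block is always the
    one taken. *)
Lemma inner_col l c i x v : (1 <= l < sL s)%N -> (1 <= c <= sa s l)%N ->
  v \in sVV s l c -> inner l i x v = cyc (sHH s l c) i x v.
Proof.
move=> lL ca vc; have lL' : (1 <= l <= sL s)%N by lia.
rewrite /inner -lt0n sp_gt0 //.
apply: (sum_graph_in (vs_VV vs lL') (D := fun c => cyc (sHH s l c) i)) => // c' ca'.
exact: cyc_graph (sHH_average lL' ca') (sHH_size_gt0 lL' ca') _.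
Qed.

Lemma rev_iotaS t : rev (iota 1 t.+1) = t.+1 :: rev (iota 1 t).
Proof. by rewrite -[in LHS](addn1 t) iotaD rev_cat add1n. Qed.

(* Total correctness: the loop never gets stuck, and each outcome satisfies Q. *)
Definition total m ls E b (Q : 'M[R]_n -> (nat -> nat) -> Prop) : Prop :=
  (exists E' b', for_loop k s m ls E b E' b') /\
  forall E' b', for_loop k s m ls E b E' b' -> Q E' b'.

Lemma total_nil m E b (Q : 'M[R]_n -> (nat -> nat) -> Prop) :
  Q E b -> total m [::] E b Q.
Proof.
move=> QE; split=> [|E' b' loop]; first by exists E, b; apply: For_nil.
by inversion loop; subst.
Qed.

Lemma total_cons m l ls E b Q : (exists E1 b1, for_body k s m l E b E1 b1) ->
  (forall E1 b1, for_body k s m l E b E1 b1 -> total m ls E1 b1 Q) ->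
  total m (l :: ls) E b Q.
Proof.
move=> [E1 [b1 body]] tot; split=> [|E' b' loop].
  have [[E' [b' loop]] _] := tot E1 b1 body.
  by exists E', b'; apply: For_cons body loop.
inversion loop as [|? ? ? ? E2 b2 ? ? body2 loop2]; subst.
by have [_ ] := tot E2 b2 body2; apply.
Qed.

Lemma total_weaken m ls E b (Q Q' : 'M[R]_n -> (nat -> nat) -> Prop) :
  (forall E' b', Q E' b' -> Q' E' b') -> total m ls E b Q -> total m ls E b Q'.
Proof. by move=> QQ' [ex all_Q]; split=> // E' b' /all_Q/QQ'. Qed.

Lemma total_average m t E b : (m <= m1)%N ->
  total m (rev (iota 1 t)) E b (fun E' b' =>
    E' = E + \sum_(1 <= l < t.+1) cyc (sH s l) m /\ b' = b).
Proof.
move=> mm1; elim: t E => [|t IHt] E.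
  by apply: total_nil; rewrite big_geq ?addr0.
rewrite rev_iotaS; apply: total_cons; rewrite /for_body mm1; first by do 2!eexists.
move=> _ _ [-> ->]; apply: total_weaken (IHt _) => E' b' [-> ->]; split=> //.
by rewrite [in RHS]big_nat_recr //= -addrA [cyc _ _ + _]addrC.
Qed.

(** The disjunction lists the two situations in which every pass l <= t reaches the last case: the
    passes below j in round m1 + j, and all passes once m >= m1 + L, where m = m1 + l forces l =
    L. *)
Lemma total_inner m t E b : (m1 < m)%N ->
  (m1 + t < m)%N \/ (t <= sL s)%N /\ (m1 + sL s <= m)%N ->
  total m (rev (iota 1 t)) E b (fun E' b' =>
    E' = E + \sum_(1 <= l < t.+1) inner l (b l).+1 /\
    forall l, b' l = (b l + (1 <= l <= t))%N).
Proof.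
move=> mm1; elim: t E b => [|t IHt] E b tm.
  by apply: total_nil; split=> [|[|l]]; rewrite ?big_geq ?addr0 ?addn0.
have body E1 b1 : for_body k s m t.+1 E b E1 b1 <->
    b1 = [eta b with t.+1 |-> (b t.+1).+1] /\ E1 = E + inner t.+1 (b t.+1).+1.
  rewrite /for_body leqNgt mm1 /= ltnNge (_ : (m1 + t.+1 <= m)%N) /=; last lia.
  by rewrite (_ : _ && _ = false) //; lia.
rewrite rev_iotaS; apply: total_cons => [|E1 b1 /body[-> ->]].
  by do 2!eexists; apply/body.
apply: total_weaken (IHt _ _ _); last lia.
move=> E' b' [-> b'E]; split=> [|l]; last first.
  rewrite b'E /=; case: eqP => [->|lt]; last by congr (_ + _)%N; lia.
  by rewrite ltnn andbF addn0 leqnn addn1.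
rewrite [in RHS]big_nat_recr //= -addrA [inner _ _ + _]addrC; congr (_ + (_ + _)).
by apply: eq_big_nat => l lt; rewrite ltn_eqF //; lia.
Qed.

Section CrossingRound.
Variable j : nat.
Hypothesis jL : (1 <= j < sL s)%N.

Lemma tail_card_le t : (j <= t)%N -> (tail_card t.+1 <= tail_card j.+1)%N.
Proof.
move=> jt; rewrite -!card_tail //; apply: subset_leq_card; apply/subsetP => x.
by case/tailP => l lL xl; apply/tailP; exists l => //; lia.
Qed.

(** Because l runs downwards, all sets after V_j are linked before the pass l = j groups what is
    left; the passes l < j then touch only sets disjoint from [tail j]. *)
Lemma total_crossing t E b : (j <= t <= sL s)%N -> linked j (tail t.+1) E ->
  total (m1 + j) (rev (iota 1 t)) E b (fun E' b' =>
    (exists2 F, crossing j F & E' = F + \sum_(1 <= l < j) inner l (b l).+1) /\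
    forall l, b' l = (b l + (1 <= l < j))%N).
Proof.
have jL' : (1 <= j <= sL s)%N by lia.
have j_m1 : (m1 + j <= m1)%N = false by lia.
elim: t E b => [|t IHt] E b tj lE; first lia.
rewrite rev_iotaS; have [jt|jt] : j = t.+1 \/ (j <= t)%N by lia.
  have body E1 b1 : for_body k s (m1 + j) t.+1 E b E1 b1 <->
      group_isolated k (sV s j) E E1 /\ b1 = b.
    rewrite /for_body j_m1 -jt ltnn eqxx /= (_ : (j != sL s) = true) //; lia.
  apply: total_cons => [|F b1 /body[gF ->]].
    by have [F gF] := group_isolated_exists (sV s j) E k1; exists F, b; apply/body.
  rewrite -jt in lE; have crF := group_crossing jL lE gF.
  have tm : (m1 + t < m1 + j)%N by lia.
  have mm : (m1 < m1 + j)%N by lia.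
  apply: total_weaken (total_inner F b mm (or_introl tm)) => E' b' [-> b'E].
  by rewrite jt; split=> //; exists F; rewrite // jt in crF *.
have body E1 b1 : for_body k s (m1 + j) t.+1 E b E1 b1 <->
    (exists ws : seq 'I_n, [/\ uniq ws, ws =i sV s t.+1 & link s j ws E E1]) /\ b1 = b.
  by rewrite /for_body j_m1 ltn_add2l ltnS jt addKn.
have tL : (t.+1 <= sL s)%N by lia.
have wsP (ws : seq 'I_n) : ws =i sV s t.+1 -> forall x, x \in ws ->
    (x \notin tail t.+2) && (x \notin sV s j).
  move=> wsE x; rewrite wsE => xt; apply/andP; split.
    by apply: sV_notin_tail xt; lia.
  by apply: (splits_notin Vsplit _ jL' xt); lia.
apply: total_cons => [|E1 b1 /body[[ws [uws wsE lk]] ->]].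
  have mem_ws := wsP _ (mem_enum (sV s t.+1)).
  have [|E1 lk] := link_exists jL (enum_uniq (sV s t.+1)) mem_ws _ lE.
    rewrite -cardE card_tail // addnC -tail_card_recl //.
    by apply: leq_ltn_trans (tail_card_lt jL'); apply: tail_card_le.
  exists E1, b; apply/body; split=> //; exists (enum (sV s t.+1)).
  by split=> //; [apply: enum_uniq | apply: mem_enum].
apply: IHt; first lia.
rewrite (tail_recl tL) setUC (_ : sV s t.+1 = [set x in ws]).
  exact: link_linked lk uws (wsP _ wsE) lE.
by apply/setP => x; rewrite inE wsE.
Qed.

End CrossingRound.

(* The value of b_l after m rounds. *)
Definition inner_count m l :=
  if l == sL s then (m.+1 - (m1 + l))%N else (m - (m1 + l))%N.

(** The clauses describe the initial averaging, the crossing rounds m1 + j with j < L, and the final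
    rounds. V_L is never grouped, so its counter already advances in round m1 + L, whereas for l < L
    it first advances in round m1 + l + 1. *)
Definition round m E : Prop :=
  [/\ (m <= m1)%N -> E = \sum_(1 <= l < (sL s).+1) cyc (sH s l) m,
      forall j, (1 <= j < sL s)%N -> m = (m1 + j)%N ->
        exists2 F, crossing j F & E = F + \sum_(1 <= l < j) inner l (inner_count m l)
    & (m1 + sL s <= m)%N ->
        E = \sum_(1 <= l < (sL s).+1) inner l (inner_count m l)].

Lemma total_round m b : (0 < m)%N ->
  (forall l, (1 <= l <= sL s)%N -> b l = inner_count m.-1 l) ->
  total m (rev (iota 1 (sL s))) 0 b (fun E b' => round m E /\
    forall l, (1 <= l <= sL s)%N -> b' l = inner_count m l).
Proof.
move=> m0 bE; have [mm1|m1m] := leqP m m1.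
  apply: total_weaken (total_average _ _ _ mm1) => _ _ [-> ->]; split.
    by split=> [_|j jL|]; [rewrite add0r | lia | lia].
  by move=> l lL; rewrite bE // /inner_count; case: ifP; lia.
have [mL|Lm] := ltnP m (m1 + sL s).
  have [j jL mj] : exists2 j, (1 <= j < sL s)%N & m = (m1 + j)%N.
    by exists (m - m1)%N; lia.
  have jL' : (j <= sL s <= sL s)%N by lia.
  have l0 : linked j (tail (sL s).+1) 0.
    by rewrite /tail big_geq //; apply: linked0.
  have := total_crossing jL b jL' l0; rewrite -mj.
  apply: total_weaken => E' b' [[F crF ->] b'E]; split.
    split=> [|j' jL'' mj'|]; [lia | | lia].
    have -> : j' = j by lia.
    exists F => //; congr (_ + _); apply: eq_big_nat => l lj; rewrite bE; last lia.
    by congr inner; rewrite /inner_count; case: ifP; lia.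
  by move=> l lL; rewrite b'E bE // /inner_count; case: ifP; lia.
have cnt l : (1 <= l <= sL s)%N -> (b l).+1 = inner_count m l.
  by move=> lL; rewrite bE // /inner_count; case: ifP; lia.
have mm := conj (leqnn (sL s)) Lm.
apply: total_weaken (total_inner 0 b m1m (or_intror mm)) => _ b' [-> b'E]; split.
  split=> [|j' jL'' mj'|_]; try lia.
  by rewrite add0r; apply: eq_big_nat => l lL; rewrite cnt.
by move=> l lL; rewrite b'E lL addn1 cnt.
Qed.

(** The counter of V_1 stands at m - (m1 + 1) after m rounds and stops the loop on reaching p_1, the
    length of H_k(V_{1,1}). *)
Notation M := (m1 + 1 + sp s 1)%N.

Lemma size_sHH11 : size (sHH s 1 1) = sp s 1.
Proof.
have lL : (1 <= 1 <= sL s)%N by lia.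
have ca : (1 <= 1 <= sa s 1)%N by have /andP[-> _] := vs_dig vs lL.
have [ns] := hyper_hypercube_size (vs_HH vs lL ca); rewrite sVV_card // => nsP ->.
by apply: min_factorization_pow nsP => //; apply: sp_gt0; lia.
Qed.

Lemma while_loop_rounds m b : (m <= M)%N ->
  (forall l, (1 <= l <= sL s)%N -> b l = inner_count m l) ->
  (exists Es, while_loop k s m b Es) /\
  forall Es, while_loop k s m b Es -> size Es = (M - m)%N /\
    forall i, (i < M - m)%N -> round (m + i).+1 (nth 0 Es i).
Proof.
have count1 i : inner_count i 1 = (i - (m1 + 1))%N.
  by rewrite /inner_count; case: ifP => //; lia.
have p0 : (0 < sp s 1)%N by apply: sp_gt0; lia.
move dM: (M - m)%N => d; elim: d m b dM => [|d IHd] m b dM mM bE.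
  have stop : (size (sHH s 1 1) <= b 1)%N by rewrite size_sHH11 bE ?count1; lia.
  split=> [|Es]; first by exists [::]; apply: While_stop.
  move=> loop; inversion loop as [|? ? ? ? ? go]; subst; first by split.
  by rewrite ltnNge stop in go.
have go : (b 1 < size (sHH s 1 1))%N by rewrite size_sHH11 bE ?count1; lia.
have [[E [b' loop]] tot] := @total_round m.+1 b isT bE.
have dM' : (M - m.+1 = d)%N by lia.
have mM' : (m.+1 <= M)%N by lia.
split=> [|Es].
  have [_ b'E] := tot E b' loop.
  have [[Es w] _] := IHd m.+1 b' dM' mM' b'E.
  by exists (E :: Es); apply: While_step go loop w.
move=> loop'; inversion loop' as [? ? stop|? ? E1 b1 Es1 _ loop1 w1]; subst.
  by rewrite leqNgt go in stop.
have [rE b1E] := tot E1 b1 loop1.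
have [_ /(_ Es1 w1)[<- rounds]] := IHd m.+1 b1 erefl mM' b1E.
split=> // [[_|i iM]]; first by rewrite addn0.
by rewrite -addSnnS; apply: rounds.
Qed.

Lemma size_sH_digit l : (1 <= l <= sL s)%N ->
  (sp s l <= size (sH s l) <= (sp s l).+1)%N.
Proof.
move=> lL; have [ns] := hyper_hypercube_size (vs_H vs lL).
rewrite sV_card // => nsP ->; exact: min_factorization_digit k1 (vs_dig vs lL) nsP.
Qed.

(** For l > 1 the length is at most p_l + 1 <= p_1 <= m1, so m1 rounds complete at least one pass
    through every H_k(V_l). *)
Lemma size_sH_le l : (1 <= l <= sL s)%N -> (size (sH s l) <= m1)%N.
Proof.
move=> lL; have [->//|l1] : l = 1%N \/ (1 < l)%N by lia.
have L1 : (1 <= 1 <= sL s)%N by lia.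
have p_lt : (sp s l < sp s 1)%N by apply: (vs_pow vs); lia.
have /andP[_ le_l] := size_sH_digit lL; have /andP[le_1 _] := size_sH_digit L1; lia.
Qed.

Lemma sL_le : (sL s <= sp s 1 + 1)%N.
Proof. by have := @sp_add_leq (sL s); lia. Qed.

Lemma tail_natrE j : (1 <= j)%N ->
  (tail_card j)%:R = \sum_(j <= l < (sL s).+1) #|sV s l|%:R :> R.
Proof. by move=> j1; rewrite /tail_card natr_sum. Qed.

Lemma sum_tail j (f : 'I_n -> R) : (1 <= j)%N ->
  \sum_(x in tail j) f x = \sum_(j <= l < (sL s).+1) \sum_(x in sV s l) f x.
Proof.
move=> j1; have [jL|jL] := ltnP (sL s) j.
  by rewrite /tail !big_geq // big_set0.
move dj: (sL s - j)%N => d; elim: d j j1 jL dj => [|d IHd] j j1 jL dj;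
  rewrite (tail_recl jL) big_ltn //.
  have -> : j = sL s by lia.
  by rewrite /tail !big_geq // setU0 addr0.
have jL' : (j.+1 <= sL s)%N by lia.
have dj' : (sL s - j.+1 = d)%N by lia.
rewrite -(IHd j.+1 isT jL' dj') -bigU /=.
  by apply: eq_bigl => x; rewrite in_setU.
rewrite disjoint_subset; apply/subsetP => x; exact: sV_notin_tail.
Qed.

(** * Effect of a crossing round on the values *)

Section CrossingStep.
Variables (j : nat) (F : 'M[R]_n) (x : 'I_n -> R) (y : nat -> R).
Hypotheses (jL : (1 <= j < sL s)%N) (crF : crossing j F).
Hypothesis xy : forall l v, (j <= l <= sL s)%N -> v \in sV s l -> x v = y l.
Let jL' : (1 <= j <= sL s)%N. Proof. by lia. Qed.
Notation w := (link_weight s j).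

(** All neighbours of v lie in V_j and carry y_j, so only their total weight a_j [w] = N_j / T_j
    matters. *)
Lemma mix_crossing_tail l v : (j < l <= sL s)%N -> v \in sV s l ->
  mix F x v = y l + (#|sV s j|%:R / (tail_card j)%:R) * (y j - y l).
Proof.
move=> lL vl; have vt : v \in tail j.+1 by apply/tailP; exists l; rewrite // lL.
have lL' : (j <= l <= sL s)%N by lia.
rewrite /mix (xy lL' vl) -sa_link_weight //; congr (_ + _).
rewrite (bigID (mem (sV s j))) /= [X in _ + X]big1 ?addr0 => [|i ij]; last first.
  by rewrite (crossing_supp crF) // mul0r.
rewrite (eq_bigr (fun i => F i v * (y j - y l))) => [|i ij]; last first.
  by rewrite (xy (l := j)) //; lia.
rewrite -mulr_suml (sum_splits (vs_VV vs jL')); congr (_ * _).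
rewrite (eq_big_nat _ _ (F2 := fun=> w)) => [|c ca].
  by rewrite sumr_const_nat subSS subn0 mulr_natl.
exact: crossing_sum.
Qed.

(** Terms inside V_j vanish because V_j is constant, including those of the grouping cliques. Summed
    over the block, each node of the later sets then contributes with total weight [w], whichever
    partner it selected. *)
Lemma sum_mix_crossing_block c : (1 <= c <= sa s j)%N ->
  \sum_(u in sVV s j c) mix F x u = (k.+1 ^ sp s j)%:R * y j +
    w * \sum_(j.+1 <= l < (sL s).+1) #|sV s l|%:R * (y l - y j).
Proof.
move=> ca; have gF := crossing_graph crF.
have uj u : u \in sVV s j c -> u \in sV s j by apply: sVV_sub.
have jj : (j <= j <= sL s)%N by lia.
rewrite big_split /= (eq_bigr (fun=> y j)) => [|u /uj uc]; last exact: xy uc.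
rewrite sumr_const sVV_card // -[y j *+ _]mulr_natl; congr (_ + _).
rewrite (eq_bigr (fun u => \sum_(i in tail j.+1) F i u * (x i - y j))); last first.
  move=> u /uj uc; rewrite (bigID (mem (tail j.+1))) /= [X in _ + X]big1 ?addr0.
    by apply: eq_bigr => i _; rewrite (xy jj uc).
  move=> i it; have [ij|ij] := boolP (i \in sV s j).
    by rewrite !(xy jj) // subrr mulr0.
  rewrite (graph_supp gF) ?mul0r // tail_recl ?in_setU ?negb_or ?ij //; lia.
rewrite exchange_big /= mulr_sumr sum_tail //.
apply: eq_big_nat => l lL; rewrite -sumr_const mulr_suml mulr_sumr.
apply: eq_bigr => i il; rewrite -mulr_suml.
have it : i \in tail j.+1 by apply/tailP; exists l.
rewrite (xy (l := l)) //; last lia.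
under eq_bigr => u _ do rewrite (graph_sym gF).
rewrite mul1r; congr (_ * _).
by rewrite -(crossing_sum crF it ca); apply: eq_bigr => u _; rewrite (graph_sym gF).
Qed.

End CrossingStep.

(** * Values along the whole run of the simple graph *)

Section Rounds.
Variable Es : seq 'M[R]_n.
Hypothesis size_Es : size Es = M.
Hypothesis rounds : forall i, (i < M)%N -> round i.+1 (nth 0 Es i).

Lemma round_graph m E : (0 < m)%N -> round m E -> graph_on V E.
Proof.
move=> m0 [avgE crE innE]; have [mm1|mm1] := leqP m m1.
  rewrite avgE //; apply: (graph_on_splits Vsplit) => // l lL.
  exact: cyc_graph (sH_average lL) (sH_size_gt0 lL) _.
have [mL|Lm] := ltnP m (m1 + sL s); last first.
  by rewrite innE //; apply: (graph_on_splits Vsplit) => // l lL; apply: inner_graph.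
have jL : (1 <= m - m1 < sL s)%N by lia.
have mj : (m = m1 + (m - m1))%N by lia.
have [F crF ->] := crE _ jL mj.
have sVT l : (1 <= l < m - m1)%N -> sV s l \subset V :\: tail (m - m1).
  move=> lj; apply/subsetP => v vl; rewrite inE (sV_notin_tail _ _ vl) /=; try lia.
  by apply: (subsetP (splits_sub Vsplit _)) vl; lia.
have tV : tail (m - m1) \subset V.
  apply/subsetP => v /tailP[l lL vl].
  by apply: (subsetP (splits_sub Vsplit _)) vl; lia.
apply: (graph_on_add tV (subsetDl _ (tail (m - m1)))) (crossing_graph crF) _.
  rewrite disjoint_sym disjoints_subset; apply/subsetP => v.
  by rewrite !inE => /andP[].
apply: graph_on_sum sVT _ => [l lj|l l' lj lj' ll']; first by apply: inner_graph; lia.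
by have [_ dV _] := Vsplit; apply: dV => //; lia.
Qed.

Lemma round_col_average m E l x v : (m <= m1)%N -> (1 <= l <= sL s)%N -> round m E ->
  v \in sV s l -> E x v = cyc (sH s l) m x v.
Proof.
move=> mm1 lL [-> // _ _] vl.
apply: (sum_graph_in Vsplit (D := fun l => cyc (sH s l) m)) vl => // l' lL'.
exact: cyc_graph (sH_average lL') (sH_size_gt0 lL') _.
Qed.

Lemma round_col_crossing j E : (1 <= j < sL s)%N -> round (m1 + j) E ->
  exists2 F, crossing j F & forall x v, v \in tail j -> E x v = F x v.
Proof.
move=> jL [_ crE _]; have [F crF ->] := crE j jL erefl.
exists F => // x v vt; rewrite mxE [X in _ + X](_ : _ = 0) ?addr0 //.
apply: sum_graph_out => [l lj|l lj]; first by apply: inner_graph; lia.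
by apply: contraL vt => vl; apply: sV_notin_tail vl; lia.
Qed.

Lemma round_col_inner m E l x v : (1 <= l <= sL s)%N -> (m1 < m)%N ->
  (m1 + l < m)%N || (m1 + sL s <= m)%N -> round m E ->
  v \in sV s l -> E x v = inner l (inner_count m l) x v.
Proof.
move=> lL mm1 lm [_ crE innE] vl; have [mL|Lm] := ltnP m (m1 + sL s); last first.
  rewrite innE //.
  apply: (sum_graph_in Vsplit (D := fun l => inner l (inner_count m l))) vl => // l' lL'.
  exact: inner_graph.
have jL : (1 <= m - m1 < sL s)%N by lia.
have mj : (m = m1 + (m - m1))%N by lia.
have [F crF ->] := crE _ jL mj.
have lj : (1 <= l < m - m1)%N by lia.
have vt : v \notin tail (m - m1) by apply: sV_notin_tail vl; lia.
rewrite mxE (graph_supp_r _ (crossing_graph crF)) // add0r.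
apply: (sum_graph_in Vsplit (D := fun l => inner l (inner_count m l))) vl => //; first lia.
by move=> l' lj'; apply: inner_graph; lia.
Qed.

Variable x0 : 'I_n -> R.
Let X m := run (take m Es) x0.
Let mean : R := #|V|%:R^-1 * \sum_(v in V) x0 v.

Lemma take_run_S m : (m < M)%N -> X m.+1 = mix (nth 0 Es m) (X m).
Proof. by move=> mM; rewrite /X (take_nth 0) ?size_Es // run_rcons. Qed.

Lemma run_average_phase l v : (1 <= l <= sL s)%N -> v \in sV s l ->
  X m1 v = #|sV s l|%:R^-1 * \sum_(u in sV s l) x0 u.
Proof.
move=> lL vl.
have [gC avC] := cyc_average (sH_average lL) (sH_size_gt0 lL) (size_sH_le lL).
have m1M : (m1 <= M)%N by lia.
rewrite -(avC x0 v vl).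
apply: (@run_local _ _ (sV s l)) => // [|m u i|F u i FC ul il].
- by rewrite size_takel ?size_Es // size_mkseq.
- rewrite size_mkseq => mm1 ul; rewrite nth_take // nth_mkseq //.
  by apply: round_col_average => //; apply: rounds; apply: leq_trans mm1 m1M.
- exact: graph_supp (gC F FC) _ _ il.
Qed.

Lemma run_crossing_phase j : (j < sL s)%N -> exists y : nat -> R,
  (forall l v, (j.+1 <= l <= sL s)%N -> v \in sV s l -> X (m1 + j) v = y l) /\
  \sum_(j.+1 <= l < (sL s).+1) #|sV s l|%:R * y l = (tail_card j.+1)%:R * mean.
Proof.
have L_le := sL_le.
elim: j => [|j IHj] jL.
  exists (fun l => #|sV s l|%:R^-1 * \sum_(u in sV s l) x0 u); split.
    by move=> l v lL vl; rewrite addn0; apply: run_average_phase.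
  transitivity (\sum_(v in V) x0 v).
    rewrite (sum_splits Vsplit); apply: eq_big_nat => l lL.
    by rewrite mulrA divff ?mul1r // pnatr_eq0 -lt0n sV_gt0.
  have cV : #|V| = tail_card 1.
    rewrite (splits_card Vsplit); apply: eq_big_nat => l lL.
    by rewrite sV_card.
  rewrite /mean cV mulrA divff ?mul1r // pnatr_eq0 -lt0n tail_card_recl; last lia.
  by rewrite addn_gt0 sV_gt0 //; lia.
have [y [Xy sum_y]] := IHj (ltnW jL).
have jL1 : (1 <= j.+1 < sL s)%N by lia.
have jM : (m1 + j < M)%N by lia.
have := rounds jM; rewrite -addnS => /(round_col_crossing jL1)[F crF EF].
exists (fun l => y l + (#|sV s j.+1|%:R / (tail_card j.+1)%:R) * (y j.+1 - y l)); split.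
  move=> l v lL vl; rewrite addnS take_run_S //.
  rewrite -(mix_crossing_tail jL1 crF Xy lL vl).
  apply: (@mix_local _ _ (tail j.+1)) => // [u i ut|u i ut it|]; first exact: EF.
    exact: graph_supp (crossing_graph crF) _ _ it.
  by apply/tailP; exists l => //; lia.
have t0 := lt0r_neq0 (tail_card_gt0 jL1).
move: sum_y t0; rewrite tail_card_recl ?natrD; last lia.
rewrite big_ltn; last lia.
have -> : \sum_(j.+2 <= l < (sL s).+1) #|sV s l|%:R *
    (y l + #|sV s j.+1|%:R / (#|sV s j.+1|%:R + (tail_card j.+2)%:R) * (y j.+1 - y l)) =
    \sum_(j.+2 <= l < (sL s).+1) #|sV s l|%:R * y l +
    #|sV s j.+1|%:R / (#|sV s j.+1|%:R + (tail_card j.+2)%:R) *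
    ((tail_card j.+2)%:R * y j.+1 - \sum_(j.+2 <= l < (sL s).+1) #|sV s l|%:R * y l).
  rewrite tail_natrE // mulr_suml -sumrB mulr_sumr -big_split /=.
  by apply: eq_bigr => l _; ring.
(* With N and T the sizes of the current set and of the sets after it, and A their weighted sum of
   values, the claim becomes A + N / (N + T) (T y - A) = T (N y + A) / (N + T). *)
move: (\sum_(j.+2 <= l < _) _) => A; move: (#|sV s j.+1|%:R) ((tail_card j.+2)%:R).
move=> N T sum_y t0.
have -> : mean = (N * y j.+1 + A) / (N + T) by rewrite sum_y mulrAC divff ?mul1r.
by field.
Qed.

(** With q = (k+1)^(p_j) and N_j = a_j q, the link weight is q / T_j. The block sum then collapses
    to q / T_j times the weighted sum of the y_l over l >= j, which is T_j times the mean; this is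
    the purpose of the weight. *)
Lemma run_block_mean j c : (1 <= j < sL s)%N -> (1 <= c <= sa s j)%N ->
  \sum_(u in sVV s j c) X (m1 + j) u = (k.+1 ^ sp s j)%:R * mean.
Proof.
case: j => // j jL ca; have L_le := sL_le.
have [|y [Xy sum_y]] := run_crossing_phase (j := j); first lia.
have jM : (m1 + j < M)%N by lia.
have jL' : (1 <= j.+1 <= sL s)%N by lia.
have := rounds jM; rewrite -addnS => /(round_col_crossing jL)[F crF EF].
rewrite [in X _]addnS take_run_S //.
transitivity (\sum_(u in sVV s j.+1 c) mix F (X (m1 + j)) u).
  apply: eq_bigr => u /(sVV_sub jL' ca) uj.
  apply: (@mix_local _ _ (tail j.+1)) => // [v i vt|v i vt it|]; first exact: EF.
    exact: graph_supp (crossing_graph crF) _ _ it.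
  by apply/tailP; exists j.+1 => //; lia.
rewrite (sum_mix_crossing_block jL crF Xy ca).
have t0 := lt0r_neq0 (tail_card_gt0 jL); have a0 := lt0r_neq0 (sa_gt0 jL).
have := sV_card jL'; rewrite link_weightE.
have -> : \sum_(j.+2 <= l < (sL s).+1) #|sV s l|%:R * (y l - y j.+1) =
    \sum_(j.+2 <= l < (sL s).+1) #|sV s l|%:R * y l - (tail_card j.+2)%:R * y j.+1.
  rewrite tail_natrE // mulr_suml -sumrB.
  by apply: eq_bigr => l _; rewrite mulrBr.
move: sum_y t0; rewrite big_ltn; last lia.
rewrite tail_card_recl ?natrD; last lia.
move: (\sum_(j.+2 <= l < _) _) => A; move: (#|sV s j.+1|) ((tail_card j.+2)%:R).
move=> N T sum_y t0 NE; rewrite NE natrM in sum_y t0 *.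
move: (sa s j.+1)%:R (k.+1 ^ _)%:R a0 sum_y t0 => a q a0 sum_y t0.
have -> : mean = (a * q * y j.+1 + A) / (a * q + T) by rewrite sum_y mulrAC divff ?mul1r.
by field; rewrite t0 a0.
Qed.

Lemma run_mean v : v \in V -> run Es x0 v = mean.
Proof.
move=> /(splits_mem Vsplit)[l lL vl]; have L_le := sL_le.
have rest i : (i < M)%N -> run Es x0 = run (drop i Es) (X i).
  by move=> iM; rewrite -run_cat cat_take_drop.
have [lL'|lL'] : l = sL s \/ (1 <= l < sL s)%N by lia.
  have [|y [Xy sum_y]] := run_crossing_phase (j := (sL s).-1); first lia.
  have L1 : (sL s).-1.+1 = sL s by lia.
  move: sum_y Xy; rewrite L1 big_nat1 /tail_card big_nat1 => sum_y Xy.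
  (* After the last crossing round the weighted mean runs over V_L alone, so V_L already carries the
     global mean and the remaining rounds keep it constant. *)
  have yL : y (sL s) = mean.
    by apply: (mulfI _ sum_y); rewrite pnatr_eq0 -lt0n -lL' sV_gt0.
  rewrite (rest (m1 + (sL s).-1)%N); last lia.
  apply: (@run_const _ _ (sV s l)) vl => [E u i|u ul].
    move=> /(nthP 0)[t]; rewrite size_drop size_Es nth_drop => tM <- ul il.
    rewrite (@round_col_inner _ _ _ _ _ lL _ _ (rounds _)) //; try lia.
    exact: graph_supp (inner_graph _ lL) _ _ il.
  by rewrite -yL; apply: Xy; rewrite -?lL' //; lia.
have [c ca vc] := splits_mem (vs_VV vs lL) vl.
have L_p := sp_add_leq lL.
rewrite (rest (m1 + l)%N); last lia.
(* There are p_1 + 1 - l rounds left, at least the p_l that H_k of a block requires. *)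
have size_c : (size (sHH s l c) <= M - (m1 + l))%N.
  have [ns] := hyper_hypercube_size (vs_HH vs lL ca); rewrite sVV_card // => nsP ->.
  rewrite (min_factorization_pow k1 _ nsP); last exact: sp_gt0.
  lia.
have [gC avC] := cyc_average (sHH_average lL ca) (sHH_size_gt0 lL ca) size_c.
have := avC (X (m1 + l)) v vc.
rewrite run_block_mean // sVV_card // mulrA mulVf ?mul1r => [<-|].
  apply: (@run_local _ _ (sVV s l c)) vc => // [|m u i|F u i FC ul il].
  - by rewrite size_drop size_Es size_mkseq.
  - rewrite size_mkseq nth_drop => mM uc; rewrite nth_mkseq //.
    rewrite (@round_col_inner _ _ _ _ _ lL _ _ (rounds _)) ?(sVV_sub lL ca) //; try lia.
    rewrite (@inner_col _ c) //; congr (cyc _ _ _ _).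
    by rewrite /inner_count; case: ifP; lia.
  - exact: graph_supp (gC F FC) _ _ il.
by rewrite pnatr_eq0 -lt0n expn_gt0.
Qed.

Lemma rounds_graph E : E \in Es -> graph_on V E.
Proof.
move=> /(nthP 0)[i]; rewrite size_Es => iM <-; exact: round_graph (rounds iM).
Qed.

End Rounds.

Lemma while_loop_average Es : while_loop k s 0 (fun=> 0%N) Es ->
  averages V Es /\ (size Es <= (sp s 1).*2.+2)%N.
Proof.
have b0 l : (1 <= l <= sL s)%N -> 0%N = inner_count 0 l.
  by move=> lL; rewrite /inner_count; case: ifP; lia.
have [_ sound] := @while_loop_rounds 0 (fun=> 0%N) (leq0n _) b0.
move=> /sound[]; rewrite subn0 => size_Es rounds.
split; last first.
  have L1 : (1 <= 1 <= sL s)%N by lia.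
  have /andP[_] := size_sH_digit L1; rewrite size_Es; lia.
split=> [E|x v]; first exact: rounds_graph.
exact: run_mean.
Qed.

End Splitting.

(** * Existence and length of the simple graph *)

Section SimpleBaseGraph.
Variables (R : realType) (n k : nat).
Hypothesis k1 : (1 <= k)%N.
Implicit Types (V : {set 'I_n}) (s : splitting R n) (Es : seq 'M[R]_n).

Lemma base_expansion q m : (m < k.+1 ^ q)%N ->
  exists L (a p : nat -> nat),
  [/\ m = (\sum_(1 <= l < L.+1) a l * k.+1 ^ p l)%N,
      forall l l', (1 <= l)%N -> (l < l')%N -> (l' <= L)%N -> (p l' < p l)%N,
      forall l, (1 <= l <= L)%N -> (1 <= a l <= k)%N
    & forall l, (1 <= l <= L)%N -> (p l < q)%N].
Proof.
elim: q m => [|q IHq] m mq.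
  exists 0%N, id, id; split=> [|l l'|l|l]; [|lia|lia|lia].
  by rewrite big_geq //; move: mq; rewrite expn0; lia.
have K0 : (0 < k.+1 ^ q)%N by rewrite expn_gt0.
have [L [a [p [mE p_dec a_dig p_lt]]]] := IHq (m %% k.+1 ^ q)%N (ltn_pmod _ K0).
have [d0|d0] := posnP (m %/ k.+1 ^ q).
  exists L, a, p; split=> // [|l lL]; last by apply: leq_trans (p_lt l lL) _.
  by rewrite -mE [LHS](divn_eq _ (k.+1 ^ q)) d0.
(* The new leading digit sits at index 1 and the others shift by one. A zero leading digit was
   skipped above, since digits must be positive. *)
exists L.+1, (fun l => if l is l'.+2 then a l'.+1 else m %/ k.+1 ^ q)%N,
  (fun l => if l is l'.+2 then p l'.+1 else q); split.
- rewrite big_ltn // big_add1 /= [LHS](divn_eq _ (k.+1 ^ q)) mE; congr addn.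
  by apply: eq_big_nat => -[|l].
- case=> [|[|l]] [|[|l']] // _ ll' lL; first by apply: p_lt; lia.
  by apply: p_dec; lia.
- case=> [|[|l]] // lL; last by apply: a_dig; lia.
  by rewrite d0 /= -ltnS ltn_divLR // -expnS.
- case=> [|[|l]] // lL; rewrite ltnS; last by apply: ltnW; apply: p_lt; lia.
Qed.

Lemma splits_exists V L (c : nat -> nat) : #|V| = (\sum_(1 <= l < L.+1) c l)%N ->
  exists Vs, splits V L Vs c.
Proof.
elim: L V => [|L IHL] V cV.
  exists (fun=> set0); split=> [|l l'|l]; [|lia|lia].
  by rewrite big_geq //; apply: cards0_eq; rewrite cV big_geq.
rewrite big_nat_recr //= in cV.
have [W sWV cW] : exists2 W : {set 'I_n}, W \subset V & #|W| = c L.+1.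
  by apply: subset_of_card; rewrite cV leq_addl.
have [|Vs [VE dV cVs]] := IHL (V :\: W).
  by rewrite cardsD (setIidPr sWV) cV cW addnK.
have VsW l : (1 <= l <= L)%N -> [disjoint Vs l & W].
  move=> lL; rewrite disjoints_subset; apply/subsetP => x xl.
  suff : x \in V :\: W by rewrite !inE => /andP[].
  by rewrite VE; apply/bigcup_natP; exists l.
exists (fun l => if l == L.+1 then W else Vs l); split.
- rewrite big_nat_recr //= eqxx (eq_big_nat _ _ (F2 := Vs)) => [|l lL].
    by rewrite -VE -{1}(setID V W) (setIidPr sWV) setUC.
  by rewrite ltn_eqF //; lia.
- move=> l l' lL lL' ll'; case: eqP => l1; case: eqP => l1'.
  + by rewrite l1 l1' eqxx in ll'.
  + by rewrite disjoint_sym VsW //; lia.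
  + by rewrite VsW //; lia.
  + by apply: dV => //; lia.
- by move=> l lL; case: eqP => [-> //|l1]; apply: cVs; lia.
Qed.

Lemma valid_splitting_exists V : exists s : splitting R n, valid_splitting k V s.
Proof.
have V_lt : (#|V| < k.+1 ^ #|V|)%N by apply: ltn_expl.
have [L [a [p [VE p_dec a_dig _]]]] := base_expansion V_lt.
have [Vs sV] := splits_exists VE.
have [_ _ cV] := sV.
have /choice[VVs sVV] l : exists VVs, (1 <= l <= L)%N ->
    splits (Vs l) (a l) VVs (fun=> k.+1 ^ p l)%N.
  have [lL|] := boolP (1 <= l <= L)%N; last by exists (fun=> set0).
  have [|VVs sVV] := @splits_exists (Vs l) (a l) (fun=> k.+1 ^ p l)%N.
    by rewrite sum_nat_const_nat subSS subn0 cV.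
  by exists VVs.
have /choice[H hH] l : exists H, (1 <= l <= L)%N -> hyper_hypercube (R := R) k (Vs l) H.
  have [lL|] := boolP (1 <= l <= L)%N; last by exists [::].
  have al := a_dig l lL; have /andP[a1 _] := al.
  have [||H hH] := @hyper_hypercube_exists R n k (Vs l); rewrite ?cV //.
  - by rewrite muln_gt0 a1 expn_gt0.
  - exact: smooth_digit.
  by exists H.
have /choice[HH hHH] (lc : nat * nat) : exists H,
    (1 <= lc.1 <= L)%N -> (1 <= lc.2 <= a lc.1)%N ->
    hyper_hypercube (R := R) k (VVs lc.1 lc.2) H.
  case: lc => l c /=.
  have [lL|] := boolP (1 <= l <= L)%N; last by exists [::].
  have [ca|] := boolP (1 <= c <= a l)%N; last by exists [::].
  have [_ _ /(_ c ca) cVV] := sVV l lL.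
  have [||H' hH'] := @hyper_hypercube_exists R n k (VVs l c); rewrite ?cVV //.
  - by rewrite expn_gt0.
  - by rewrite -[(k.+1 ^ _)%N]mul1n; apply: smooth_digit; rewrite k1.
  by exists H'.
exists (Splitting L a p Vs VVs H (fun l c => HH (l, c))).
by split=> //= l c lL ca; apply: hHH (l, c) lL ca.
Qed.

(** A single digit a (k+1)^p is smooth, and so is 0 by the convention for [primes]; outside the
    smooth case at least two digits remain, so V_1 differs from V_L. *)
Lemma valid_splitting_sL V s : valid_splitting k V s -> ~~ smooth k #|V| ->
  (1 < sL s)%N.
Proof.
move=> vs; apply: contraNltn => L1.
have [L0|L_1] : sL s = 0%N \/ sL s = 1%N by lia.
  by rewrite (vs_base vs) L0 big_geq.
rewrite (vs_base vs) L_1 big_nat1; apply: smooth_digit.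
by apply: (vs_dig vs); rewrite L_1.
Qed.

Lemma simple_base_graph_exists V : (0 < #|V|)%N ->
  exists Es : seq 'M[R]_n, simple_base_graph k V Es.
Proof.
move=> V0; rewrite /simple_base_graph; case: (boolP (smooth k #|V|)) => smV.
  exact: hyper_hypercube_exists.
have [s vs] := valid_splitting_exists V; have L2 := valid_splitting_sL vs smV.
have b0 l : (1 <= l <= sL s)%N -> 0%N = inner_count s 0 l.
  by move=> lL; rewrite /inner_count; case: ifP; lia.
have [[Es wEs] _] := while_loop_rounds k1 vs L2 (leq0n _) b0.
by exists Es, s.
Qed.

Lemma simple_base_graph_average V Es : simple_base_graph k V Es -> averages V Es.
Proof.
rewrite /simple_base_graph; case: ifPn => smV; first exact: hyper_hypercube_average.
move=> [s [vs wEs]]; have L2 := valid_splitting_sL vs smV.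
by have [] := while_loop_average k1 vs L2 wEs.
Qed.

(** In the smooth case one factor k+1 <= n is split off and the others give n^2, hence n^3.
    Otherwise the length is at most 2 (p_1 + 1), and (k+1)^(p_1 + 1) <= n^2 since k+1 and
    (k+1)^(p_1) are both at most n. *)
Lemma simple_base_graph_size V Es : (k < #|V|)%N -> simple_base_graph k V Es ->
  (k.+1 ^ size Es <= #|V| ^ 4)%N.
Proof.
move=> kV; rewrite /simple_base_graph; case: ifPn => smV.
  move=> /hyper_hypercube_size[ns nsP ->].
  apply: (@leq_trans (#|V| ^ 3)); last by rewrite leq_pexp2l //; lia.
  have ns0 : (0 < size ns)%N by case: nsP => -[].
  rewrite -(prednK ns0) expnSr (expnSr _ 2); apply: leq_mul => //.
  exact: min_factorization_size nsP.
move=> [s [vs wEs]]; have L2 := valid_splitting_sL vs smV.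
have [_ size_Es] := while_loop_average k1 vs L2 wEs.
apply: (@leq_trans (k.+1 ^ ((sp s 1).+1 * 2))).
  by rewrite leq_pexp2l // muln2.
have L1 : (1 <= 1 <= sL s)%N by lia.
rewrite expnM (expnM _ 2 2) leq_exp2r // expnS -mulnn leq_mul //.
apply: leq_trans (subset_leq_card (splits_sub (vs_V vs) L1)).
by rewrite (sV_card vs) // leq_pmull //; have /andP[] := vs_dig vs L1.
Qed.

End SimpleBaseGraph.

(** * The Base-(k+1) Graph *)

Section Relabel.
Variables (R : realType) (n k : nat) (f : 'S_n).
Implicit Types (E F : 'M[R]_n) (V A B : {set 'I_n}) (s : splitting R n).

Lemma mem_relabel A x : (x \in [set f y | y in A]) = ((f^-1)%g x \in A).
Proof. by rewrite -{1}(permKV f x) mem_imset //; apply: perm_inj. Qed.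

Lemma card_relabel A : #|[set f y | y in A]| = #|A|.
Proof. by rewrite card_imset //; apply: perm_inj. Qed.

Lemma relabelD E F : relabel f (E + F) = relabel f E + relabel f F.
Proof. by apply/matrixP => x y; rewrite !mxE. Qed.

Lemma relabel0 : relabel f 0 = 0 :> 'M[R]_n.
Proof. by apply/matrixP => x y; rewrite !mxE. Qed.

Lemma relabel_sum (I : Type) (r : seq I) (F : I -> 'M[R]_n) :
  relabel f (\sum_(i <- r) F i) = \sum_(i <- r) relabel f (F i).
Proof. by apply: (big_morph _ relabelD relabel0). Qed.

Lemma permV_eq x y : ((f^-1)%g x == y) = (x == f y).
Proof. by rewrite (can2_eq (permKV f) (permK f)). Qed.

Lemma relabel_hyper_edges ns (v : seq 'I_n) l :
  relabel f (hyper_edges R ns v l) = hyper_edges R ns (map f v) l.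
Proof.
apply/matrixP => x y; rewrite -(permKV f x) -(permKV f y).
move: (f^-1 x)%g (f^-1 y)%g => {}x {}y; rewrite !mxE !permK.
rewrite !mem_map; try exact: perm_inj.
rewrite (inj_eq (@perm_inj _ f)); congr (if [&& _, _, _ & _] then _ else _).
by apply: eq_forallb => l'; rewrite !index_map //; exact: perm_inj.
Qed.

Lemma relabel_hyper_hypercube V S : hyper_hypercube k V S ->
  hyper_hypercube k [set f x | x in V] (map (relabel (R := R) f) S).
Proof.
move=> [ns [v [nsP uv vV ->]]]; exists ns, (map f v); split.
- by rewrite card_relabel.
- by rewrite map_inj_uniq //; apply: perm_inj.
- move=> x; rewrite mem_relabel -vV -{1}(permKV f x) mem_map //; exact: perm_inj.
- by rewrite /mkseq -map_comp; apply: eq_map => l; apply: relabel_hyper_edges.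
Qed.

Lemma relabel_splits V L Vs c : splits V L Vs c ->
  splits [set f x | x in V] L (fun l => [set f x | x in Vs l]) c.
Proof.
move=> [VE dV cV]; split.
- apply/setP => x; rewrite mem_relabel VE.
  by apply/bigcup_natP/bigcup_natP => -[l lL xl]; exists l => //;
    move: xl; rewrite mem_relabel.
- move=> l l' lL lL' ll'; rewrite disjoint_subset; apply/subsetP => x.
  rewrite !inE !mem_relabel => xl; by rewrite (disjointFr (dV l l' lL lL' ll')).
- by move=> l lL; rewrite card_relabel cV.
Qed.

Definition relabel_splitting s : splitting R n :=
  Splitting (sL s) (sa s) (sp s) (fun l => [set f x | x in sV s l])
    (fun l c => [set f x | x in sVV s l c]) (fun l => map (relabel f) (sH s l))
    (fun l c => map (relabel f) (sHH s l c)).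

Lemma relabel_valid_splitting V s : valid_splitting k V s ->
  valid_splitting k [set f x | x in V] (relabel_splitting s).
Proof.
move=> vs; split=> /=.
- by rewrite card_relabel; apply: vs_base vs.
- exact: vs_pow vs.
- exact: vs_dig vs.
- exact: relabel_splits (vs_V vs).
- by move=> l lL; apply: relabel_splits (vs_VV vs lL).
- by move=> l lL; apply: relabel_hyper_hypercube (vs_H vs lL).
- by move=> l c lL ca; apply: relabel_hyper_hypercube (vs_HH vs lL ca).
Qed.

Lemma relabel_cyc (S : seq 'M[R]_n) i :
  relabel f (cyc S i) = cyc (map (relabel f) S) i.
Proof.
rewrite /cyc size_map; have [lt|le] := ltnP (i.-1 %% size S) (size S).
  by rewrite (nth_map 0).
by rewrite !nth_default ?size_map // relabel0.
Qed.

Lemma relabel_edge v u (w : R) : relabel f (edge v u w) = edge (f v) (f u) w.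
Proof. by apply/matrixP => x y; rewrite !mxE !permV_eq. Qed.

Lemma relabel_clique V : relabel f (clique R V) = clique R [set f x | x in V].
Proof.
apply/matrixP => x y; rewrite !mxE !mem_relabel card_relabel.
by rewrite (inj_eq (@perm_inj _ (f^-1)%g)).
Qed.

Lemma relabel_isolated E : isolated (relabel f E) = [set f x | x in isolated E].
Proof.
apply/setP => x; rewrite mem_relabel; apply/isolatedP/isolatedP => H y.
  by have := H (f y); rewrite mxE permK.
by rewrite mxE H.
Qed.

Lemma relabel_setI A B :
  [set f x | x in A :&: B] = [set f x | x in A] :&: [set f x | x in B].
Proof. by apply/setP => x; rewrite in_setI !mem_relabel in_setI. Qed.

Lemma relabel_link s j ws E E' : link s j ws E E' ->
  link (relabel_splitting s) j (map f ws) (relabel f E) (relabel f E').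
Proof.
have wE : link_weight (relabel_splitting s) j = link_weight s j.
  rewrite /link_weight /= card_relabel; congr (_ / (_ * _)%N%:R).
  by apply: eq_bigr => l _; rewrite card_relabel.
elim=> {ws E E'} [E|v ws u E E' uE _ IH] /=; first exact: Link_nil.
apply: (Link_cons (u := fun c => f (u c))) => [c ca|] /=.
  by rewrite relabel_isolated -relabel_setI mem_relabel permK; apply: uE.
move: IH; rewrite relabelD relabel_sum wE.
by under [X in link _ _ _ (_ + X)]eq_bigr do rewrite relabel_edge.
Qed.

Lemma relabel_group_isolated V E E' : group_isolated k V E E' ->
  group_isolated k [set f x | x in V] (relabel f E) (relabel f E').
Proof.
have cE F : #|[set f x | x in V] :&: isolated (relabel f F)| = #|V :&: isolated F|.
  by rewrite relabel_isolated -relabel_setI card_relabel.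
elim=> {E E'} [E E2|V' E E' E2 sV' cV' _ IH].
  by apply: Group_stop; rewrite cE.
apply: (Group_step (V' := [set f x | x in V'])); rewrite ?cE ?card_relabel //.
  by rewrite relabel_isolated -relabel_setI imsetS.
by rewrite -relabel_clique -relabelD.
Qed.

Lemma relabel_for_body s m l E b E' b' : for_body k s m l E b E' b' ->
  for_body k (relabel_splitting s) m l (relabel f E) b (relabel f E') b'.
Proof.
rewrite /for_body /= size_map; case: ifP => _.
  by move=> [-> ->]; rewrite relabelD relabel_cyc.
case: ifP => _.
  move=> [[ws [uws wsE lk]] ->]; split=> //; exists (map f ws); split.
  - by rewrite map_inj_uniq //; apply: perm_inj.
  - by move=> x; rewrite mem_relabel -wsE -{1}(permKV f x) mem_map //; apply: perm_inj.
  - exact: relabel_link.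
case: ifP => _; first by move=> [gE ->]; split=> //; apply: relabel_group_isolated.
move=> [-> ->]; split=> //; rewrite relabelD; congr (_ + _); case: ifP => _.
  by rewrite relabel_sum; apply: eq_bigr => c _; rewrite relabel_cyc.
exact: relabel_cyc.
Qed.

Lemma relabel_for_loop s m ls E b E' b' : for_loop k s m ls E b E' b' ->
  for_loop k (relabel_splitting s) m ls (relabel f E) b (relabel f E') b'.
Proof.
elim=> {ls E b E' b'} [E b|l ls E b E1 b1 E' b' body _ IH]; first exact: For_nil.
exact: For_cons (relabel_for_body body) IH.
Qed.

Lemma relabel_while_loop s m b Es : while_loop k s m b Es ->
  while_loop k (relabel_splitting s) m b (map (relabel f) Es).
Proof.
elim=> {m b Es} [m b stop|m b E b' Es go loop _ IH] /=.
  by apply: While_stop; rewrite /= size_map.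
apply: While_step IH; first by rewrite /= size_map.
by rewrite -relabel0; apply: relabel_for_loop.
Qed.

Lemma relabel_simple_base_graph V Es : simple_base_graph k V Es ->
  simple_base_graph k [set f x | x in V] (map (relabel (R := R) f) Es).
Proof.
rewrite /simple_base_graph card_relabel; case: ifP => _.
  exact: relabel_hyper_hypercube.
move=> [s [vs wEs]]; exists (relabel_splitting s).
by split; [apply: relabel_valid_splitting | apply: relabel_while_loop].
Qed.

End Relabel.

Lemma relabel1 (R : realType) n (E : 'M[R]_n) : relabel 1%g E = E.
Proof. by apply/matrixP => x y; rewrite mxE invg1 !perm1. Qed.

(** Each set is listed before its complement, and equal positions in the two lists are matched. *)
Lemma exists_perm_imset n (A B : {set 'I_n}) : #|A| = #|B| ->
  exists f : 'S_n, [set f x | x in A] = B.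
Proof.
move=> cAB; pose enumC (C : {set 'I_n}) := enum C ++ enum (~: C).
have size_enumC C : size (enumC C) = n by rewrite size_cat -!cardE cardsC card_ord.
have mem_enumC C x : x \in enumC C by rewrite mem_cat !mem_enum inE orbN.
have uniq_enumC C : uniq (enumC C).
  rewrite cat_uniq !enum_uniq andbT /=; apply/hasPn => x /=.
  by rewrite !mem_enum inE.
pose g x := nth x (enumC B) (index x (enumC A)).
have lt_idx x : (index x (enumC A) < n)%N.
  by rewrite -[X in (_ < X)%N](size_enumC A) index_mem.
have g_inj : injective g.
  move=> x y; rewrite /g (set_nth_default x) ?size_enumC // => /eqP.
  by rewrite nth_uniq ?size_enumC // => /eqP/index_inj; apply.
exists (perm g_inj); apply/eqP; rewrite eqEcard card_imset ?cAB ?leqnn ?andbT;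
  last exact: perm_inj.
apply/subsetP => _ /imsetP[x xA ->]; rewrite permE /g index_cat mem_enum xA.
have lt_x : (index x (enum A) < size (enum B))%N.
  by rewrite -cardE -cAB cardE index_mem mem_enum.
by rewrite nth_cat lt_x -mem_enum mem_nth.
Qed.

(** * The concatenated sequence *)

Section ProductGraph.
Variables (R : realType) (n k : nat).
Hypothesis k1 : (1 <= k)%N.

Lemma same_way_exists (P : {set 'I_n} -> seq 'M[R]_n -> Prop)
    (Vs : nat -> {set 'I_n}) L c :
  (forall (f : 'S_n) V S, P V S -> P [set f x | x in V] (map (relabel f) S)) ->
  (exists S, P (Vs 1%N) S) -> (forall l, (1 <= l <= L)%N -> #|Vs l| = c) ->
  exists A, forall l, (1 <= l <= L)%N ->
    P (Vs l) (A l) /\ same_way (Vs 1%N) (A 1%N) (Vs l) (A l).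
Proof.
move=> Pf [S PS] cV.
have /choice[A AP] l : exists T, (1 <= l <= L)%N ->
    (* The last clause makes the chosen sequence at index 1 equal to S itself, the common reference
       of all copies. *)
    [/\ P (Vs l) T, same_way (Vs 1%N) S (Vs l) T & l = 1%N -> T = S].
  have [lL|] := boolP (1 <= l <= L)%N; last by exists [::].
  have [->|l1] := eqVneq l 1%N.
    exists S; split=> //; exists 1%g; split.
      by rewrite -[RHS]imset_id; apply: eq_imset => x; rewrite perm1.
    by rewrite -[LHS]map_id; apply: eq_map => E; rewrite relabel1.
  have [|f fV] := @exists_perm_imset n (Vs 1%N) (Vs l).
    by rewrite !cV //; lia.
  exists (map (relabel f) S); split; [|by exists f|by move/eqP: l1].
  by rewrite -fV; apply: Pf.
exists A => l lL; have [PA sA _] := AP l lL.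
by have [|_ _ ->] := AP 1%N _; first lia.
Qed.

Lemma product_graph_exists : (0 < n)%N ->
  exists Es : seq 'M[R]_n, product_graph k [set: 'I_n] Es.
Proof.
(* The factor p collects the prime powers of n with prime at most k+1, and q collects the others. *)
move=> n0; pose pi : nat_pred := [pred r | (r <= k.+1)%N].
pose p := (n`_pi)%N; pose q := (n`_pi^')%N.
have npq : n = (p * q)%N by rewrite partnC.
have p0 : (0 < p)%N by apply: part_gt0.
have q0 : (0 < q)%N by apply: part_gt0.
have sm_p : smooth k p.
  by apply/smoothP => // r pr rp; have /pnatP := part_pnat pi n; apply.
have q_coprime c : (2 <= c <= k.+1)%N -> coprime q c.
  move=> ck; rewrite coprime_sym; apply: (@pnat_coprime pi); last exact: part_pnat.
  have c0 : (0 < c)%N by lia.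
  by apply/pnatP => // r _ /(dvdn_leq c0) rc; rewrite inE; lia.
(* Node i is the pair of its quotient and remainder modulo q: rows give the V_l, columns the U_l,
   and [e] is the inverse of this coding. *)
pose Vs (l : nat) := [set i : 'I_n | (i %/ q).+1 == l].
pose Us (l : nat) := [set i : 'I_n | (i %% q).+1 == l].
pose e a b : 'I_n := insubd (Ordinal n0) (a * q + b)%N.
have eE a b : (a < p)%N -> (b < q)%N -> val (e a b) = (a * q + b)%N.
  move=> ap bq; rewrite val_insubd ifT // npq.
  by apply: (@leq_trans (a.+1 * q)); rewrite ?leq_mul2r ?ap ?orbT // mulSn addnC ltn_add2r.
have e_div a b : (a < p)%N -> (b < q)%N -> (e a b %/ q)%N = a.
  by move=> ap bq; rewrite eE // divnMDl // divn_small ?addn0.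
have e_mod a b : (a < p)%N -> (b < q)%N -> (e a b %% q)%N = b.
  by move=> ap bq; rewrite eE // modnMDl modn_small.
have div_lt (i : 'I_n) : (i %/ q < p)%N by rewrite ltn_divLR // -npq.
have mod_lt (i : 'I_n) : (i %% q < q)%N by rewrite ltn_mod.
have e_id (i : 'I_n) : e (i %/ q)%N (i %% q)%N = i.
  by apply: val_inj; rewrite eE // -divn_eq.
have cardVs l : (1 <= l <= p)%N -> #|Vs l| = q.
  move=> lp; have lp' : (l.-1 < p)%N by lia.
  have -> : Vs l = [set e l.-1 b | b : 'I_q].
    apply/setP => i; rewrite inE; apply/eqP/imsetP => [<-|[b _ ->]].
      by exists (Ordinal (mod_lt i)); rewrite //= e_id.
    by rewrite e_div // prednK //; lia.
  rewrite card_imset ?card_ord // => b b' /(congr1 (fun i : 'I_n => i %% q)%N).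
  by rewrite !e_mod // => /val_inj.
have cardUs l : (1 <= l <= q)%N -> #|Us l| = p.
  move=> lq; have lq' : (l.-1 < q)%N by lia.
  have -> : Us l = [set e a l.-1 | a : 'I_p].
    apply/setP => i; rewrite inE; apply/eqP/imsetP => [<-|[a _ ->]].
      by exists (Ordinal (div_lt i)); rewrite //= e_id.
    by rewrite e_mod // prednK //; lia.
  rewrite card_imset ?card_ord // => a a' /(congr1 (fun i : 'I_n => i %/ q)%N).
  by rewrite !e_div // => /val_inj.
have splVs : splits [set: 'I_n] p Vs (fun=> q).
  split=> //.
    apply/setP => i; rewrite inE; apply/esym/bigcup_natP.
    by exists (i %/ q).+1; [exact: div_lt | rewrite inE].
  move=> l l' _ _ ll'; rewrite disjoint_subset; apply/subsetP => i.
  by rewrite !inE => /eqP ->.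
have splUs : splits [set: 'I_n] q Us (fun=> p).
  split=> //.
    apply/setP => i; rewrite inE; apply/esym/bigcup_natP.
    by exists (i %% q).+1; [exact: mod_lt | rewrite inE].
  move=> l l' _ _ ll'; rewrite disjoint_subset; apply/subsetP => i.
  by rewrite !inE => /eqP ->.
have cross l l' : (1 <= l <= q)%N -> (1 <= l' <= p)%N -> #|Us l :&: Vs l'| = 1%N.
  move=> lq lp'; have lq1 : (l.-1 < q)%N by lia. have lp1 : (l'.-1 < p)%N by lia.
  rewrite -(cards1 (e l'.-1 l.-1)); congr #|pred_of_set _|; apply/setP => i.
  rewrite !inE; apply/andP/eqP => [[/eqP <- /eqP <-]|->]; first by rewrite e_id.
  by rewrite e_div // e_mod // !prednK ?eqxx; lia.
have [|A AP] := same_way_exists (Vs := Vs) (@relabel_simple_base_graph R n k) _ cardVs.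
  by apply: simple_base_graph_exists => //; rewrite cardVs // p0.
have [|H HP] := same_way_exists (Vs := Us) (@relabel_hyper_hypercube R n k) _ cardUs.
  by apply: hyper_hypercube_exists; rewrite cardUs // q0.
exists (union_seq p A ++ union_seq q H), p, q, Vs, Us, A, H; split=> //.
by rewrite cardsT card_ord.
Qed.

Lemma union_seq_average (V : {set 'I_n}) L Vs c (S : nat -> seq 'M[R]_n) :
  splits V L Vs c -> (forall l, (1 <= l <= L)%N -> averages (Vs l) (S l)) ->
  (forall l, (1 <= l <= L)%N -> size (S l) = size (S 1%N)) ->
  (forall E, E \in union_seq L S -> graph_on V E) /\
  forall x l v, (1 <= l <= L)%N -> v \in Vs l ->
    run (union_seq L S) x v = #|Vs l|%:R^-1 * \sum_(u in Vs l) x u.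
Proof.
move=> sV avS size_S.
have gS m l : (m < size (S 1%N))%N -> (1 <= l <= L)%N -> graph_on (Vs l) (nth 0 (S l) m).
  by move=> mS lL; have [gS _] := avS l lL; apply: gS; rewrite mem_nth // size_S.
split=> [E /mapP[m]|x l v lL vl].
  rewrite mem_iota add0n => /= mS ->.
  by apply: (graph_on_splits sV) => // l lL; apply: gS.
have [gSl avSl] := avS l lL; rewrite -(avSl x v vl).
apply: (@run_local _ _ (Vs l)) vl => // [|m u i|F u i FS ul il].
- by rewrite size_mkseq size_S.
- rewrite size_S // => mS ul; rewrite nth_mkseq //.
  by apply: (sum_graph_in sV (D := fun l => nth 0 (S l) m)) ul => // l' lL'; apply: gS.
- exact: graph_supp (gSl F FS) _ _ il.
Qed.

(** After the first half, every node holds the mean of its own V_l'. The set U_l meets each V_l'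
    exactly once, so its average is the mean of these p means, which is the global mean because all
    V_l' have the same size q. *)
Lemma product_graph_average (V : {set 'I_n}) (Es : seq 'M[R]_n) :
  product_graph k V Es -> averages V Es.
Proof.
move=> [p [q [Vs [Us [A [H [[cV _ _] [sVs sUs cross] AP HP ->]]]]]]].
have size_same S T (B C : {set 'I_n}) : same_way (R := R) B S C T -> size T = size S.
  by case=> f [_ ->]; rewrite size_map.
have [||g1 av1] := @union_seq_average V p Vs (fun=> q) A sVs.
- by move=> l /AP[/(simple_base_graph_average k1)].
- by move=> l /AP[_ /size_same].
have [||g2 av2] := @union_seq_average V q Us (fun=> p) H sUs.
- by move=> l /HP[/hyper_hypercube_average].
- by move=> l /HP[_ /size_same].
split=> [E|x v vV]; first by rewrite mem_cat => /orP[/g1|/g2].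
have [l lq vl] := splits_mem sUs vV.
rewrite run_cat (av2 _ l) // cV natrM invfM -mulrA.
have [_ _ cVs] := sVs; have [_ _ cUs] := sUs.
rewrite cUs //; congr (_ * _); rewrite (sum_splits sVs) mulr_sumr.
transitivity (\sum_(u in V) if u \in Us l then run (union_seq p A) x u else 0).
  rewrite -big_mkcondr /=; apply: eq_bigl => u; rewrite andbC.
  by case: (boolP (u \in Us l)) => // /(subsetP (splits_sub sUs lq)).
rewrite (sum_splits sVs); apply: eq_big_nat => l' lp'.
rewrite -big_mkcondr /=.
have /eqP/cards1P[z zE] := cross l l' lq lp'.
rewrite (eq_bigl (fun u => u \in [set z])) => [|u]; last by rewrite -zE in_setI andbC.
rewrite big_set1 (av1 _ l') //; first by rewrite cVs.
by have := set11 z; rewrite -zE => /setIP[].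
Qed.

End ProductGraph.

(** * Passage to logarithms and conclusion *)

Lemma natr_le_logb (R : realType) k m s : (1 <= k)%N -> (0 < m)%N ->
  (k.+1 ^ s <= m ^ 4)%N -> s%:R <= 4%:R * logb k.+1%:R m%:R :> R.
Proof.
move=> k1 m0 le_pow; have K0 : 0 < ln k.+1%:R :> R by rewrite ln_gt0 // ltr1n.
rewrite /logb mulrA ler_pdivlMr // !mulr_natl -!lnXn ?ltr0n //.
by rewrite ler_ln ?posrE ?exprn_gt0 ?ltr0n // -!natrX ler_nat.
Qed.

Theorem corollary1 (R : realType) :
  exists C : R, forall n k : nat, (1 <= k <= n - 1)%N ->
    [/\ exists Es : seq 'M[R]_n, simple_base_graph k [set: 'I_n] Es,
        forall Es : seq 'M[R]_n, simple_base_graph k [set: 'I_n] Es ->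
          finite_time_convergent (size Es) Es /\
          (size Es)%:R <= C * logb k.+1%:R n%:R,
        exists Es : seq 'M[R]_n, base_graph k [set: 'I_n] Es
      & forall Es : seq 'M[R]_n, base_graph k [set: 'I_n] Es ->
          finite_time_convergent (size Es) Es /\
          (size Es)%:R <= C * logb k.+1%:R n%:R].
Proof.
exists 4%:R => n k /andP[k1 kn].
have n0 : (0 < n)%N by lia.
have kV : (k < #|[set: 'I_n]|)%N by rewrite cardsT card_ord; lia.
have sizeP (As Es : seq 'M[R]_n) : simple_base_graph k [set: 'I_n] As ->
    (size Es <= size As)%N -> (size Es)%:R <= 4%:R * logb k.+1%:R n%:R :> R.
  move=> sA EA; apply: natr_le_logb => //.
  have := simple_base_graph_size k1 kV sA; rewrite cardsT card_ord.
  by apply: leq_trans; rewrite leq_pexp2l.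
have simple_ex : exists Es : seq 'M[R]_n, simple_base_graph k [set: 'I_n] Es.
  by apply: simple_base_graph_exists => //; apply: leq_trans kV.
split=> // [Es sE||Es [As [Ps [sA pP ->]]]].
- split; last exact: sizeP sE _.
  exact/averages_finite_time_convergent/(simple_base_graph_average k1 sE).
- have [As sA] := simple_ex; have [Ps pP] := product_graph_exists R k1 n0.
  by exists (if (size As < size Ps)%N then As else Ps), As, Ps.
- case: ltnP => AP.
    split; last exact: sizeP sA _.
    exact/averages_finite_time_convergent/(simple_base_graph_average k1 sA).
  (* The concatenated sequence is returned only when it is no longer than a simple graph, whose
     length bound it inherits. *)
  split; last exact: sizeP sA AP.
  exact/averages_finite_time_convergent/(product_graph_average k1 pP).
Qed.
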